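(* Let $n\ge 3$ and $0\le p\le n-2$ be integers, and let $G\in\mathbb{V}_n^p$, i.e. $G$ is a connected graph of order $n$ with exactly $p$ cut-vertices. Then $\mathcal{ABS}(G)\le \mathcal{ABS}(\mathbb{K}_n^p)$, where equality holds if and only if $G\cong \mathbb{K}_n^p$.
   Context: All graphs are finite and simple (no loops or multiple edges). The $\mathcal{ABS}$ (atom-bond sum connectivity) index of a graph $G$ is $\mathcal{ABS}(G)=\sum_{uv\in E(G)}\sqrt{1-\frac{2}{d(u)+d(v)}}$, where $d(v)$ is the degree of $v$ in $G$. $\mathbb{V}_n^p$ denotes the class of all connected graphs of order $n$ with exactly $p$ cut-vertices. The graph $\mathbb{K}_n^p$ (for $n\ge 3$, $0\le p\le n-2$) is defined as follows. If $n\ge 2p$, then $\mathbb{K}_n^p$ is obtained from the complete graph $K_{n-p}$ by choosing $p$ distinct vertices and attaching one pendant vertex to each of them. If $n<2p$, then $\mathbb{K}_n^p$ is obtained from $K_{n-p}$ by attaching one pendant vertex to each of $n-p-1$ distinct vertices, and attaching a path of length $2p-n+1$ to the one remaining vertex $u$ of $K_{n-p}$ (that is, one end vertex of a path with $2p-n+1$ edges is identified with $u$). *)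

(* Defs.v *)
From HB Require Import structures.
From mathcomp Require Import all_boot all_order all_algebra.
From mathcomp Require Import reals.

Set Implicit Arguments.
Unset Strict Implicit.
Unset Printing Implicit Defensive.

Import Order.TTheory GRing.Theory Num.Theory.

Record sgraph := SGraph {
  vertex :> finType;
  adj : rel vertex;
  adj_sym : symmetric adj;
  adj_irr : irreflexive adj
}.
Arguments adj {s}.

Definition deg (G : sgraph) (v : G) : nat := #|[set w | adj v w]|.

Definition edges (G : sgraph) : {set {set G}} :=
  [set [set u.1; u.2] | u : G * G & adj u.1 u.2].

(* For an edge A = {u, v}, the inner sum over A is d(u) + d(v). *)
Definition ABS (R : realType) (G : sgraph) : R :=
  (\sum_(A in edges G)
     Num.sqrt (1 - 2%:R / (\sum_(v in A) deg v)%N%:R))%R.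

Definition connected (G : sgraph) : Prop :=
  0 < #|G| /\ forall x y : G, connect adj x y.

(* The adjacency of G - v, as a relation on the vertices of G: its vertex set
   is [predC1 v], so [n_comp (del_adj v) (predC1 v)] counts the components
   of G - v. *)
Definition del_adj (G : sgraph) (v : G) : rel G :=
  [rel x y | [&& x != v, y != v & adj x y]].

Definition cut_vertex (G : sgraph) (v : G) : bool :=
  n_comp (@adj G) [set: G] < n_comp (del_adj v) (predC1 v).

Definition in_V (n p : nat) (G : sgraph) : Prop :=
  [/\ connected G, #|G| = n & #|[set v : G | cut_vertex v]| = p].

Definition isomorphic (G H : sgraph) : Prop :=
  exists2 f : G -> H, bijective f & forall x y, adj (f x) (f y) = adj x y.

Section SimpleGraphOf.
Variables (T : finType) (r : rel T).

Definition simple_adj : rel T := [rel x y | (x != y) && (r x y || r y x)].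

Fact simple_adj_sym : symmetric simple_adj.
Proof. by move=> x y; rewrite /simple_adj /= eq_sym orbC. Qed.

Fact simple_adj_irr : irreflexive simple_adj.
Proof. by move=> x; rewrite /simple_adj /= eqxx. Qed.

Definition simple_graph_of : sgraph := SGraph simple_adj_sym simple_adj_irr.

End SimpleGraphOf.

(* The vertices 0, ..., n - p - 1 form the clique K_{n-p}, and the pendant
   vertex at a clique vertex i is n - p + i.  When n < 2p, the pendant vertices
   exhaust the indices below 2(n - p) - 1; the path starts at u = n - p - 1 and
   goes on through the 2p - n + 1 vertices 2(n - p) - 1, ..., n - 1. *)
Definition K_edge (n p i j : nat) : bool :=
  [|| (i < n - p) && (j < n - p)
    | if 2 * p <= n then (i < p) && (j == n - p + i)
      else [|| (i < n - p - 1) && (j == n - p + i),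
               (i == n - p - 1) && (j == 2 * (n - p) - 1)
             | (2 * (n - p) - 1 <= i) && (j == i.+1)]].

Definition KK (n p : nat) : sgraph :=
  simple_graph_of [rel i j : 'I_n | K_edge n p i j].

(* Main.v *)
Require Import Defs.
From mathcomp Require Import all_boot all_order all_algebra.
From mathcomp Require Import reals.
From mathcomp Require Import zify ring lra.

(** Put [m = n - p] and [f s = sqrt (1 - 2/s)]. Adding an edge that keeps all
    cut vertices strictly increases ABS, so one may assume that every pair of
    non-adjacent vertices is separated by a cut vertex whose removal leaves
    exactly two components. Such a graph is a tree of cliques (the line graph
    of a tree). Root it at a clique [D] of maximum order [a], and let [b v] be
    the number of children of [v]: then [b v > 0] exactly at the cut vertices
    and [a + sum (b v - 1) = m], the sum being over the cut vertices.

    If [a = m], the graph is a clique of order [m] with pendant paths, and ABS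
    depends only on the number [q] of paths and the number [s] of paths of
    length at least 2. Concavity of [f] makes [q = min m p], [s = [p > m]] the
    best choice, and these values determine the graph.

    If [a < m], there are at least two blocks of order at least 3, and a crude
    count suffices: all degrees are at most [m], the blocks of order at least 3
    contain at most [m(m-1)/2] edges, and at most [p - 1] edges are bridges.
    When [p > m], a bridge is charged [f 4] plus [f (m+1) - f 4] for each of its
    ends lying in a block of order at least 3. *)

Set Implicit Arguments.
Unset Strict Implicit.
Unset Printing Implicit Defensive.

Import Order.TTheory GRing.Theory Num.Theory.

(** * Edge-maximal graphs *)

Lemma del_adjE (G : sgraph) (c x y : G) :
  del_adj c x y = [&& x != c, y != c & adj x y].
Proof. by []. Qed.

Lemma del_sym (G : sgraph) (c : G) : connect_sym (del_adj c).
Proof. by apply: sym_connect_sym => x y; rewrite /del_adj /= adj_sym andbCA. Qed.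

Lemma connect_invariant (T : finType) (e : rel T) (a : pred T) (x y : T) :
  (forall u v, e u v -> a u -> a v) -> connect e x y -> a x -> a y.
Proof.
move=> inv /connectP[s]; elim: s x => [|z s IH] x /=; first by move=> _ ->.
by move=> /andP[xz zs] ylast ax; apply: (IH z) => //; exact: inv xz ax.
Qed.

Lemma connect_del_neq (G : sgraph) (c x y : G) :
  connect (del_adj c) x y -> x != c -> y != c.
Proof. by apply: (@connect_invariant _ _ (predC1 c)) => u v /and3P[]. Qed.

Lemma connect_start (T : finType) (e : rel T) (x y : T) :
  connect e x y -> x != y -> exists z, e x z.
Proof.
move=> /connectP[[|z s] /=]; first by move=> _ ->; rewrite eqxx.
by case/andP=> xz _ _ _; exists z.
Qed.

(** A connected graph has one component, so [v] is a cut vertex exactly when [G - v] has two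
    distinct component roots. *)
Lemma cut_vertexP (G : sgraph) (v : G) : connected G ->
  reflect (exists x y, [/\ x != v, y != v & ~~ connect (del_adj v) x y])
          (cut_vertex v).
Proof.
move=> [_ conG]; rewrite /cut_vertex.
have sG : connect_sym (@adj G) by apply: sym_connect_sym; exact: adj_sym.
have -> : n_comp (@adj G) [set: G] = 1.
  rewrite -(n_comp_connect sG v); apply: eq_n_comp_r => x.
  by rewrite inE; apply/esym/conG.
have sv := @del_sym G v.
apply: (iffP idP).
  case/card_gt1P=> x [y [/andP[/eqP rx xv] /andP[/eqP ry yv] xy]].
  exists x, y; split=> //; apply: contra xy => cxy.
  by rewrite -rx -ry (root_connect sv).
move=> [x [y [xv yv ncxy]]]; apply/card_gt1P.
exists (fingraph.root (del_adj v) x), (fingraph.root (del_adj v) y).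
have memr z : z != v ->
    roots (del_adj v) (fingraph.root (del_adj v) z) &&
    (fingraph.root (del_adj v) z != v).
  move=> zv; rewrite (roots_root sv).
  exact: connect_del_neq (connect_root _ z) zv.
by split; [exact: memr | exact: memr | rewrite (root_connect sv)].
Qed.

Lemma noncut_connect (G : sgraph) (v x y : G) : connected G ->
  ~~ cut_vertex v -> x != v -> y != v -> connect (del_adj v) x y.
Proof.
move=> conG ncv xv yv; apply/negPn/negP => nc; case/negP: ncv.
by apply/(cut_vertexP v conG); exists x, y.
Qed.

Definition add_edge (G : sgraph) (x y : G) : sgraph :=
  simple_graph_of [rel u v : G | adj u v || (u == x) && (v == y)].

Lemma add_edgeE (G : sgraph) (x y u v : G) : x != y ->
  @adj (add_edge x y) u v =
  [|| adj u v, (u == x) && (v == y) | (u == y) && (v == x)].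
Proof.
move=> xy; rewrite /add_edge /= /simple_adj /=.
rewrite (adj_sym v u); have [->|uv] /= := eqVneq u v.
  rewrite adj_irr /=; case: (eqVneq v x) => //= [->|_].
    by rewrite (negPf xy).
  by rewrite andbF.
by case: (adj u v) => //=; rewrite (andbC (v == x)).
Qed.

Lemma add_edge_sub (G : sgraph) (x y u v : G) : x != y ->
  adj u v -> @adj (add_edge x y) u v.
Proof. by move=> xy uv; rewrite (@add_edgeE G) // uv. Qed.

Lemma connected_add_edge (G : sgraph) (x y : G) : x != y ->
  connected G -> connected (add_edge x y).
Proof.
move=> xy [G0 conG]; split=> // u v.
apply: connect_sub (conG u v) => a b ab; apply: connect1.
exact: add_edge_sub.
Qed.

Lemma cut_add_edge (G : sgraph) (x y c : G) : x != y -> connected G ->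
  @cut_vertex (add_edge x y) c -> cut_vertex c.
Proof.
move=> xy conG /(@cut_vertexP (add_edge x y) c (connected_add_edge xy conG)).
move=> [u [v [uc vc nc]]]; apply/(cut_vertexP c conG); exists u, v; split=> //.
apply: contra nc; apply: connect_sub => a b /and3P[ac bc ab].
by apply: connect1; apply/and3P; split=> //; exact: add_edge_sub.
Qed.

(** Beyond separation, the last clause makes [G - c] have exactly two components, that of [x] and
    that of [y]. *)
Definition separates (G : sgraph) (c x y : G) : Prop :=
  [/\ x != c, y != c, ~~ connect (del_adj c) x y &
      forall z, z != c ->
        connect (del_adj c) z x \/ connect (del_adj c) z y].

(** Once the edge [xy] is added, deleting [c] leaves a connected graph. Each step of a path there is
    an old edge or the new one, so in [G - c] every vertex reaches [x] or [y]; these two lie apart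
    because [c] is a cut vertex of [G]. *)
Lemma separates_add_edge (G : sgraph) (x y c : G) : x != y ->
  connected G -> cut_vertex c -> ~~ @cut_vertex (add_edge x y) c ->
  separates c x y.
Proof.
move=> xy conG cutc ncut; have conG' := connected_add_edge xy conG.
have conn u v : u != c -> v != c -> connect (@del_adj (add_edge x y) c) u v.
  by move=> uc vc; exact: (@noncut_connect (add_edge x y)).
have [u0 [v0 [u0c v0c nc]]] := cut_vertexP c conG cutc.
have step (a b : G) : @del_adj (add_edge x y) c a b ->
    del_adj c a b \/ [/\ x != c, y != c & (a = x /\ b = y) \/ (a = y /\ b = x)].
  case/and3P=> ac bc; rewrite (@add_edgeE G) //.
  case/or3P=> [ab|/andP[/eqP ax /eqP bY]|/andP[/eqP ax /eqP bY]].
  - by left; rewrite del_adjE ac bc.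
  - by subst; right; split=> //; left.
  - by subst; right; split=> //; right.
(* If [c] were an end of the new edge, deleting [c] would delete that edge as well and [G - c] would
   already be connected. *)
have xyc : x != c /\ y != c.
  have [/andP[]//|/negP H] := boolP ((x != c) && (y != c)).
  case/negP: nc; apply: connect_sub (conn _ _ u0c v0c) => a b /step[ab|[? ? _]].
    exact: connect1.
  by case: H; apply/andP.
case: xyc => xc yc.
have reach z : z != c -> connect (del_adj c) z x \/ connect (del_adj c) z y.
  move=> zc; apply/orP.
  have := conn _ _ xc zc.
  move/(@connect_invariant _ _
    (fun z => connect (del_adj c) z x || connect (del_adj c) z y)).
  apply; last by rewrite connect0.
  move=> a b /step[ab|[_ _ [[_ ->]|[_ ->]]] _]; last 2 first.
  - by rewrite connect0 orbT.
  - by rewrite connect0.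
  have ba : connect (del_adj c) b a by rewrite del_sym connect1.
  by case/orP=> H; rewrite (connect_trans ba H) ?orbT.
split=> //; apply: contra nc => cxy.
have all_x z : z != c -> connect (del_adj c) z x.
  by case/reach=> // /connect_trans; apply; rewrite del_sym.
by apply: connect_trans (all_x _ u0c) _; rewrite del_sym all_x.
Qed.

(* The only consequence of edge-maximality (for fixed cut vertices) that the
   structure theorem uses. *)
Definition saturated (G : sgraph) : Prop :=
  forall x y : G, x != y -> ~~ adj x y -> exists c, separates c x y.

Lemma in_V_add_edge (n p : nat) (G : sgraph) (x y : G) : x != y ->
  (forall c : G, cut_vertex c -> @cut_vertex (add_edge x y) c) ->
  in_V n p G -> in_V n p (add_edge x y).
Proof.
move=> xy H [conG nG pG]; split=> //; first exact: connected_add_edge.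
rewrite -pG; apply: eq_card => c; rewrite !in_set.
by apply/idP/idP; [exact: (@cut_add_edge G) | exact: H].
Qed.

Lemma saturated_or_extend (G : sgraph) : connected G ->
  saturated G \/ exists x y : G, [/\ x != y, ~~ adj x y &
    forall c : G, cut_vertex c -> @cut_vertex (add_edge x y) c].
Proof.
move=> conG.
have [/existsP[x /existsP[y /and3P[xy nxy /forallP H]]]|N] :=
  boolP [exists x : G, exists y : G, [&& x != y, ~~ adj x y &
    [forall c : G, cut_vertex c ==> @cut_vertex (add_edge x y) c]]].
  by right; exists x, y; split=> // c cutc; exact: (implyP (H c)).
left=> x y xy nxy.
move/existsPn: N => /(_ x) /existsPn /(_ y).
rewrite xy nxy /= => /forallPn[c]; rewrite negb_imply => /andP[cutc ncut].
by exists c; exact: separates_add_edge.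
Qed.

(** * Trees of cliques *)

(** [lev] is the distance to [D], the least length of a walk ending in [D]. *)
Lemma distance_to (G : sgraph) (D : {set G}) (z0 : G) :
  connected G -> z0 \in D ->
  exists lev : G -> nat,
    [/\ forall x, (lev x == 0) = (x \in D),
        forall x, x \notin D -> exists2 y, adj x y & lev x = (lev y).+1 &
        forall x y, adj x y -> lev x <= (lev y).+1].
Proof.
move=> [_ conG] z0D.
pose P x k := [exists t : k.-tuple G, path adj x t && (last x t \in D)].
have PP x s : path adj x s -> last x s \in D -> P x (size s).
  by move=> ps ls; apply/existsP; exists (in_tuple s); rewrite ps.
have exP x : exists k, P x k.
  have /connectP[s ps ls] := conG x z0.
  by exists (size s); apply: PP; rewrite -?ls.
pose lev x := ex_minn (exP x).
have levP x : P x (lev x) by rewrite /lev; case: ex_minnP.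
have lev_min x k : P x k -> lev x <= k.
  by rewrite /lev; case: ex_minnP => m _ H /H.
have lev_adj x y : adj x y -> lev x <= (lev y).+1.
  move=> xy; have /existsP[t /andP[pt lt]] := levP y.
  by apply: lev_min; apply/existsP; exists (cons_tuple y t); rewrite /= xy pt.
exists lev; split=> // [x|x xD].
  apply/idP/idP => [/eqP l0|xD].
    by have := levP x; rewrite l0 => /existsP[t]; rewrite tuple0 /=.
  by rewrite -leqn0; apply: lev_min; apply: (PP x [::]).
have /existsP[t /andP[pt lt]] := levP x.
case: (tval t) (size_tuple t) pt lt => [|y s] /= st; first by rewrite (negPf xD).
move=> /andP[xy ps] ls; exists y => //; apply/eqP; rewrite eqn_leq lev_adj //=.
by rewrite -st ltnS; exact/lev_min/PP.
Qed.

(* The line graph of a tree: [D] is a distinguished block, every other vertex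
   [x] has a parent one level closer to [D], and the blocks other than [D]
   consist of a vertex together with all its children. The value of [par] on
   [D] is irrelevant. *)
Record clique_tree (G : sgraph) (D : {set G}) (par : G -> G) (lev : G -> nat) :
    Prop := CliqueTree {
  ct_lev0 : forall x, (lev x == 0) = (x \in D);
  ct_lev : forall x, x \notin D -> lev x = (lev (par x)).+1;
  ct_adj : forall x y, adj x y = (x != y) &&
    [|| (x \in D) && (y \in D), (x \notin D) && (par x == y),
        (y \notin D) && (par y == x)
      | [&& x \notin D, y \notin D & par x == par y]]
}.

Lemma separates_connect (G : sgraph) (c x y : G) :
  separates c x y -> ~ connect (del_adj c) x y.
Proof. by case=> _ _ /negP. Qed.

Lemma separates_nbr (G : sgraph) (c b x y : G) :
  separates c x y -> adj x b -> adj b y -> c = b.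
Proof.
move=> [xc yc nc _] xb b_y; apply/eqP/negPn/negP => cb; case/negP: nc.
rewrite eq_sym in cb.
by apply: (@connect_trans _ _ b); apply: connect1; rewrite del_adjE ?xc ?cb ?yc.
Qed.

(** A vertex separating two ends of a path of length 2 must be its middle vertex. *)
Lemma saturated_nbr (G : sgraph) (a b c : G) : saturated G ->
  adj a b -> adj b c -> a != c -> ~~ adj a c -> separates b a c.
Proof.
move=> satG ab bc ac nac; have [d sep] := satG _ _ ac nac.
by rewrite -(separates_nbr sep ab bc).
Qed.

Lemma adj_neq (G : sgraph) (x y : G) : adj x y -> x != y.
Proof. by move=> xy; apply/eqP => E; rewrite E adj_irr in xy. Qed.

(** * The parent structure forced by saturation *)

Section Saturated.
Variables (G : sgraph) (D : {set G}) (lev : G -> nat).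
Hypotheses (conG : connected G) (satG : saturated G).
Hypothesis D_clique : forall x y, x \in D -> y \in D -> x != y -> adj x y.
Hypothesis D_max : forall x, x \notin D -> exists2 y, y \in D & ~~ adj x y.
Hypothesis D_gt1 : 1 < #|D|.
Hypothesis lev0 : forall x, (lev x == 0) = (x \in D).
Hypothesis lev_next :
  forall x, x \notin D -> exists2 y, adj x y & lev x = (lev y).+1.
Hypothesis lev_adj : forall x y, adj x y -> lev x <= (lev y).+1.

(** Levels drop strictly along a shortest path from [x] to [D], so after [x] it stays below the
    level of [c] and misses [c]. *)
Lemma connect_down (c x : G) : lev x <= lev c -> x != c ->
  exists z, [/\ z \in D, z != c & connect (del_adj c) x z].
Proof.
move E : (lev x) => k; elim: k x E => [|k IH] x lx kc xc.
  by exists x; rewrite -lev0 lx connect0.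
have xD : x \notin D by rewrite -lev0 lx.
have [y xy ly] := lev_next xD.
have yc : y != c by apply: contraTneq kc => <-; lia.
have [z [zD zc yz]] := IH y ltac:(lia) ltac:(lia) yc.
exists z; split=> //; apply: connect_trans yz; apply: connect1.
by rewrite del_adjE xc yc.
Qed.

Lemma connect_low (c x y : G) : lev x <= lev c -> lev y <= lev c ->
  x != c -> y != c -> connect (del_adj c) x y.
Proof.
move=> lx ly xc yc.
have [z [zD zc xz]] := connect_down lx xc.
have [z' [zD' zc' yz]] := connect_down ly yc.
apply: connect_trans xz _; rewrite del_sym; apply: connect_trans yz _.
have [->|zz] := eqVneq z' z; first exact: connect0.
by apply: connect1; rewrite del_adjE zc' zc D_clique.
Qed.

(* Two parents [x], [y] of [v] are adjacent, as [v] does not separate them; then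
   [x] would separate [v] from a neighbour [z] of [x] that is not below [x],
   although [v - y - ... - z] avoids [x]. *)
Lemma parent_uniq (v x y : G) : v \notin D -> adj v x -> adj v y ->
  lev v = (lev x).+1 -> lev v = (lev y).+1 -> x = y.
Proof.
move=> vD vx vy lx ly; apply/eqP/negPn/negP => xy.
have [xv yv] : x != v /\ y != v.
  by split; rewrite eq_sym; exact: adj_neq.
have [axy|naxy] := boolP (adj x y); last first.
  have xv' : adj x v by rewrite adj_sym.
  have /separates_connect[] := saturated_nbr satG xv' vy xy naxy.
  by apply: connect_low => //; [rewrite lx leqnSn | rewrite ly leqnSn].
have [z zx [nzv [zy' lz]]] :
  exists2 z, adj z x & ~~ adj z v /\ z != v /\ lev z <= lev x.
  have [xD|xD] := boolP (x \in D).
    have [z zD nvz] := D_max vD.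
    have zx : z != x by apply: contraNneq nvz => ->.
    exists z; first exact: D_clique.
    split; first by rewrite adj_sym.
    split; first by apply: contraNneq vD => <-.
    by move: zD; rewrite -lev0 => /eqP ->.
  have [z xz lz] := lev_next xD; exists z; first by rewrite adj_sym.
  split; first by apply/negP; rewrite adj_sym => /lev_adj; rewrite lx lz ltnn.
  split; last by rewrite lz.
  apply/eqP => E; move: lx; rewrite lz E => /eqP.
  by rewrite -addn2 -{1}[lev v]addn0 eqn_add2l.
have xv' : adj x v by rewrite adj_sym.
have sep := saturated_nbr satG zx xv' zy' nzv.
apply: (separates_connect sep).
apply: (@connect_trans _ _ y).
  apply: connect_low; rewrite ?lz //; [|exact: adj_neq | by rewrite eq_sym].
  by move: ly; rewrite lx => -[->].
apply: connect1; rewrite del_adjE (eq_sym y x) xy (eq_sym v x) xv.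
by rewrite adj_sym.
Qed.

Definition parent (v : G) : G :=
  odflt v [pick y | adj v y && (lev v == (lev y).+1)].

Lemma parentP (v : G) : v \notin D ->
  adj v (parent v) /\ lev v = (lev (parent v)).+1.
Proof.
move=> vD; rewrite /parent; case: pickP => [y /andP[vy /eqP ly] //|N].
by have [y vy ly] := lev_next vD; move: (N y); rewrite vy ly eqxx.
Qed.

Lemma parent_eq (v x : G) : v \notin D -> adj v x -> lev v = (lev x).+1 ->
  parent v = x.
Proof.
move=> vD vx lx; have [vp lp] := parentP vD.
exact: parent_uniq lp lx.
Qed.

(** Take for [z] another vertex of [D] if [c] is in [D], and the parent of [c] otherwise: it is
    adjacent to [c] but to no child of [c]. *)
Lemma upper_nbr (c u : G) : u \notin D -> parent u = c ->
  exists z, separates c z u /\ forall v, v \notin D -> parent v = c -> separates c z v.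
Proof.
move=> uD pu.
suff [z zc H] : exists2 z, adj z c & forall v, v \notin D -> parent v = c ->
    z != v /\ ~~ adj z v.
  exists z.
  have S v : v \notin D -> parent v = c -> separates c z v.
    move=> vD pv; have [zv nzv] := H v vD pv.
    apply: saturated_nbr => //; rewrite adj_sym -pv.
    by case: (parentP vD).
  by split=> //; exact: S.
have [cD|cD] := boolP (c \in D).
  have [z zD zc] : exists2 z, z \in D & z != c.
    have /card_gt1P[a [b [aD bD ab]]] := D_gt1.
    by have [E|] := eqVneq a c; [exists b; rewrite // -E eq_sym | exists a].
  exists z; first exact: D_clique.
  move=> v vD pv; split; first by apply: contraNneq vD => <-.
  apply/negP => zv; have [vc lvc] := parentP vD; rewrite pv in vc lvc.
  case/eqP: zc; rewrite adj_sym in zv; apply: (parent_uniq vD) => //.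
  by move: cD zD; rewrite -!lev0 => /eqP cD /eqP zD; lia.
have [cz lz] := parentP cD.
exists (parent c); first by rewrite adj_sym.
move=> v vD pv; have [vc lvc] := parentP vD; rewrite pv in vc lvc.
split; first by apply/eqP => E; move: lz; rewrite E; lia.
by apply/negP; rewrite adj_sym => /lev_adj; lia.
Qed.

Lemma saturated_adj (x y : G) : adj x y = (x != y) &&
    [|| (x \in D) && (y \in D), (x \notin D) && (parent x == y),
        (y \notin D) && (parent y == x)
      | [&& x \notin D, y \notin D & parent x == parent y]].
Proof.
apply/idP/andP => [xy|[xy]]; last first.
  case/or4P=> [/andP[xD yD]|/andP[xD /eqP <-]|/andP[yD /eqP <-]|/and3P[xD yD /eqP pxy]].
  - exact: D_clique.
  - by case: (parentP xD).
  - by rewrite adj_sym; case: (parentP yD).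
  apply/negPn/negP => nxy.
  have [z [zx zall]] := upper_nbr xD (erefl _).
  have zy := zall y yD (esym pxy).
  have [px lx] := parentP xD; have [py ly] := parentP yD.
  rewrite -pxy adj_sym in py.
  (* If the siblings were not adjacent, removing their parent would leave just the components of [x]
     and [y], but that of [z] is a third one. *)
  have [_ _ _ sall] := saturated_nbr satG px py xy nxy.
  case: (sall z); first by case: zx.
    exact: separates_connect.
  exact: separates_connect.
split; first exact: adj_neq.
have yx : adj y x by rewrite adj_sym.
have [lxy|lyx|lxy] := ltngtP (lev x) (lev y).
- have ly := lev_adj yx.
  have yD : y \notin D by rewrite -lev0; lia.
  by rewrite yD (parent_eq yD yx) ?eqxx ?orbT //; lia.
- have lx := lev_adj xy.
  have xD : x \notin D by rewrite -lev0; lia.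
  by rewrite xD (parent_eq xD xy) ?eqxx ?orbT //; lia.
have eD : (y \in D) = (x \in D) by rewrite -!lev0 lxy.
have [xD|xD] := boolP (x \in D); first by rewrite eD xD.
rewrite eD xD /=.
have yD : y \notin D by rewrite eD.
have [px lx] := parentP xD.
suff H : adj y (parent x).
  by rewrite (parent_eq yD H) ?eqxx ?orbT //; lia.
rewrite adj_sym; apply/negPn/negP => npy.
have npy' : parent x != y by apply/eqP => E; rewrite E in lx; lia.
have px' : adj (parent x) x by rewrite adj_sym.
(* Here [x] would separate [parent x] from [y], yet both have level at most [lev x] and are joined
   through [D]. *)
have /separates_connect[] := saturated_nbr satG px' xy npy' npy.
by apply: connect_low; rewrite ?lxy //; [lia | exact: adj_neq | exact: adj_neq].
Qed.

(** A vertex with a child is cut by [upper_nbr]. If [c] has no child, following parents never meets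
    [c], so all other vertices reach [D] without it. *)
Lemma saturated_cut (c : G) :
  cut_vertex c = [exists x, (x \notin D) && (parent x == c)].
Proof.
apply/idP/existsP => [|[x /andP[xD /eqP px]]]; last first.
  have [z [[zc xc nzx _] _]] := upper_nbr xD px.
  by apply/(cut_vertexP c conG); exists z, x.
move=> cutc; apply/existsP; apply: contraT => /existsPn noch.
have down x : x != c -> exists z, [/\ z \in D, z != c & connect (del_adj c) x z].
  move E : (lev x) => k; elim: k x E => [|k IH] x lx xc.
    by exists x; rewrite -lev0 lx connect0.
  have xD : x \notin D by rewrite -lev0 lx.
  have [xp lp] := parentP xD.
  have pc : parent x != c by move: (noch x); rewrite xD.
  have [|z [zD zc pz]] := IH (parent x) _ pc; first by lia.
  exists z; split=> //; apply: connect_trans pz; apply: connect1.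
  by rewrite del_adjE xc pc.
have [x [y [xc yc]]] := cut_vertexP c conG cutc.
case/negP.
have [z [zD zc xz]] := down x xc.
have [z' [zD' zc' yz]] := down y yc.
apply: connect_trans xz _; rewrite del_sym; apply: connect_trans yz _.
have [->|zz] := eqVneq z' z; first exact: connect0.
by apply: connect1; rewrite del_adjE zc' zc D_clique.
Qed.

End Saturated.

Lemma saturated_clique_tree (G : sgraph) (D : {set G}) :
  connected G -> saturated G ->
  (forall x y, x \in D -> y \in D -> x != y -> adj x y) ->
  (forall x, x \notin D -> exists2 y, y \in D & ~~ adj x y) ->
  1 < #|D| ->
  exists (par : G -> G) (lev : G -> nat), clique_tree D par lev /\
    forall c, cut_vertex c = [exists x, (x \notin D) && (par x == c)].
Proof.
move=> conG satG Dc Dm D1.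
have [z zD] : exists z, z \in D by apply/card_gt0P; exact: ltnW.
have [lev [l0 ln la]] := distance_to conG zD.
exists (parent lev), lev; split; first split=> //.
- by move=> x /(parentP ln)[].
- exact: saturated_adj.
- exact: saturated_cut.
Qed.

(** * ABS as a sum over ordered pairs *)

(* Junk values: [weight R 0 = 1] and [weight R 1 = 0]; monotonicity starts at 1. *)
Definition weight (R : realType) (s : nat) : R :=
  Num.sqrt (1 - 2%:R / s%:R)%R.

Section DegreeSums.
Variables (R : realType) (G : sgraph).
Local Open Scope ring_scope.

(** Each edge is the image of exactly two ordered pairs, [(x, y)] and [(y, x)]. *)
Lemma ABS_ordered :
  2 * ABS R G = \sum_(x : G) \sum_(y : G | adj x y) weight R (deg x + deg y)%N.
Proof.
rewrite pair_big_dep /= (partition_big_imset (fun u : G * G => [set u.1; u.2])) /=.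
have -> : [set [set u.1; u.2] | u in fun u : G * G => adj u.1 u.2] = edges G.
  apply/setP => A; apply/imsetP/imsetP => -[u Hu ->];
    by exists u; rewrite ?inE // in Hu *.
rewrite /ABS mulr_sumr; apply: eq_bigr => A /imsetP[[x y]]; rewrite inE /= => xy ->.
have xny := adj_neq xy.
have -> : (\sum_(v in [set x; y]) deg v)%N = (deg x + deg y)%N.
  by rewrite big_setU1 ?inE //= big_set1.
rewrite (bigD1 (x, y)) /=; last by rewrite unfold_in /= xy eqxx.
rewrite (bigD1 (y, x)) /=; last first.
  by rewrite unfold_in /= adj_sym xy setUC eqxx /= xpair_eqE eq_sym (negPf xny).
rewrite big1 ?addr0 => [|[a b] /= /andP[/andP[/andP[+ /eqP E] nxy] nyx]].
  by rewrite (addnC (deg y)) -[Num.sqrt _]/(weight R _) mulr2n mulrDl !mul1r.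
rewrite unfold_in /= => ab; exfalso; move: nxy nyx.
have : a \in [set x; y] by rewrite -E !inE eqxx.
have : b \in [set x; y] by rewrite -E !inE eqxx orbT.
rewrite !xpair_eqE !inE; move/adj_neq: ab => ab.
by case/orP=> /eqP bE; case/orP=> /eqP aE; move: ab; rewrite bE aE ?eqxx.
Qed.
End DegreeSums.

Lemma isomorphic_ABS (R : realType) (G H : sgraph) :
  isomorphic G H -> ABS R G = ABS R H.
Proof.
move=> [f bij_f fE]; have [g fK gK] := bij_f.
have deg_f x : deg (f x) = deg x.
  rewrite /deg -(card_imset _ (bij_inj bij_f)); apply: eq_card => y.
  rewrite inE; apply/idP/imsetP => [xy|[z]].
    by exists (g y); rewrite ?gK // inE -fE gK.
  by rewrite inE => xz ->; rewrite fE.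
apply: (@mulfI R 2%:R); first by rewrite pnatr_eq0.
rewrite !ABS_ordered (reindex f) /=; last exact: onW_bij.
apply: eq_bigr => x _; rewrite [in RHS](reindex f) /=; last exact: onW_bij.
by apply: eq_big => y; rewrite ?fE // !deg_f.
Qed.

(** * Degrees and edge sums in a tree of cliques *)

Section CliqueTree.
Variables (G : sgraph) (D : {set G}) (par : G -> G) (lev : G -> nat).
Hypothesis ct : clique_tree D par lev.

Definition kids (v : G) : {set G} := [set x | x \notin D & par x == v].
Definition nkids (v : G) : nat := #|kids v|.

Lemma kidsE x v : (x \in kids v) = (x \notin D) && (par x == v).
Proof. by rewrite inE. Qed.

Lemma lev_kid x v : x \in kids v -> lev x = (lev v).+1.
Proof. by rewrite kidsE => /andP[xD /eqP <-]; exact: (ct_lev ct xD). Qed.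

Lemma kid_neq x v : x \in kids v -> x != v.
Proof. by move/lev_kid => E; apply/eqP => xv; move: E; rewrite xv; lia. Qed.

Lemma par_neq x : x \notin D -> par x != x.
Proof. by move=> xD; rewrite eq_sym; apply: kid_neq; rewrite kidsE xD eqxx. Qed.

Lemma deg_block v : v \in D -> deg v = #|D|.-1 + nkids v.
Proof.
move=> vD; have -> : #|D|.-1 = #|D :\ v| by rewrite (cardsD1 v D) vD.
rewrite /deg /nkids -cardsUI.
have -> : (D :\ v) :&: kids v = set0.
  by apply/setP => x; rewrite !inE; case: (x \in D); rewrite ?andbF.
rewrite cards0 addn0; apply: eq_card => x; rewrite !inE (ct_adj ct) vD /=.
rewrite (eq_sym x v); case: (eqVneq v x) => [<-|_] /=; first by rewrite vD.
by rewrite orbF.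
Qed.

(** The parent together with the siblings of [v] makes [nkids (par v)] neighbours, since [v] itself
    is traded for its parent. *)
Lemma deg_out v : v \notin D -> deg v = nkids (par v) + nkids v.
Proof.
move=> vD.
have vk : v \in kids (par v) by rewrite kidsE vD eqxx.
have -> : nkids (par v) = #|par v |: (kids (par v) :\ v)|.
  rewrite cardsU1 (_ : par v \notin _) ?[in LHS]/nkids ?(cardsD1 v (kids _)) ?vk //.
  by apply/negP => /setD1P[_ /kid_neq]; rewrite eqxx.
rewrite /deg /nkids -cardsUI.
have -> : (par v |: (kids (par v) :\ v)) :&: kids v = set0.
  apply/setP => x; rewrite in_set0; apply/negP => /setIP[/setU1P H xv].
  have lx := lev_kid xv; case: H => [E|/setD1P[_ /lev_kid H]].
    by have := lev_kid vk; rewrite -E; lia.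
  by have := lev_kid vk; lia.
rewrite cards0 addn0; apply: eq_card => x.
rewrite !inE (ct_adj ct) (negPf vD) /= (eq_sym x v) (eq_sym x (par v)).
case: (eqVneq v x) => [<-|_] /=; first by rewrite vD !(negPf (par_neq vD)).
rewrite (eq_sym (par v) (par x)); case: (par v == x) => //=.
by case: (x \in D) => //=; rewrite orbC.
Qed.


Lemma sum_kids (R : nmodType) (F : G -> G -> R) :
  (\sum_v \sum_(x in kids v) F v x = \sum_(x | x \notin D) F (par x) x)%R.
Proof.
rewrite [RHS](partition_big par predT) //=; apply: eq_bigr => v _.
apply: eq_big => x; first by rewrite kidsE.
by rewrite kidsE => /andP[_ /eqP->].
Qed.

Lemma sum_par (g : G -> nat) :
  \sum_(x | x \notin D) g (par x) = \sum_v nkids v * g v.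
Proof.
rewrite (partition_big par predT) //=; apply: eq_bigr => v _.
rewrite (eq_bigr (fun=> g v)); last by move=> x /andP[_ /eqP->].
by rewrite sum_nat_cond_const.
Qed.

Lemma sum_nkids : \sum_v nkids v + #|D| = #|G|.
Proof.
rewrite (eq_bigr (fun v => nkids v * 1)%N); last by move=> v; rewrite muln1.
by rewrite -(sum_par (fun=> 1)) sum1_card addnC cardC.
Qed.

Section Sums.
Local Open Scope ring_scope.
Variables (R : nmodType) (F : G -> G -> R).

(** Adjacent ordered pairs split into pairs inside [D], parent-child pairs in both orders, and
    siblings; levels make these kinds disjoint. *)
Lemma sum_adj : \sum_x \sum_(y | adj x y) F x y =
  \sum_(x in D) \sum_(y in D | y != x) F x y +
  (\sum_(x | x \notin D) (F x (par x) + F (par x) x) +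
   \sum_(x | x \notin D) \sum_(y | [&& y \notin D, y != x & par x == par y]) F x y).
Proof.
have E x : \sum_(y | adj x y) F x y =
  (if x \in D then \sum_(y in D | y != x) F x y else 0) +
  ((if x \notin D then F x (par x) else 0) + \sum_(y in kids x) F x y +
   (if x \notin D then \sum_(y | [&& y \notin D, y != x & par x == par y]) F x y else 0)).
  have -> : (if x \notin D then F x (par x) else 0) =
            \sum_(y | (x \notin D) && (par x == y)) F x y.
    have [xD|xD] := boolP (x \in D); first by rewrite big_pred0.
    by rewrite (eq_bigl (pred1 (par x))) ?big_pred1_eq // => y; rewrite /= eq_sym.
  have -> : (if x \in D then \sum_(y in D | y != x) F x y else 0) =
            \sum_(y | [&& x \in D, y \in D & y != x]) F x y.
    by have [xD|xD] := boolP (x \in D) => //=; rewrite big_pred0.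
  have -> : (if x \notin D
       then \sum_(y | [&& y \notin D, y != x & par x == par y]) F x y else 0) =
            \sum_(y | [&& x \notin D, y \notin D, y != x & par x == par y]) F x y.
    by have [xD|xD] := boolP (x \in D) => //=; rewrite big_pred0.
  rewrite [LHS]big_mkcond [X in X + _]big_mkcond [X in _ + (X + _ + _)]big_mkcond.
  rewrite [X in _ + (_ + X + _)]big_mkcond [X in _ + (_ + X)]big_mkcond -!big_split.
  apply: eq_bigr => y _; rewrite /= kidsE (ct_adj ct) (eq_sym y x).
  have [<-|xy] := eqVneq x y.
    rewrite /= !andbF; case: (boolP (x \in D)) => xD /=; first by rewrite !addr0.
    by rewrite (negPf (par_neq xD)) !addr0.
  rewrite /= andbT.
  have [xD|xD] := boolP (x \in D); have [yD|yD] := boolP (y \in D);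
    rewrite /= ?orbF ?orFb ?add0r ?addr0 //.
    have [pxy|] := eqVneq (par x) y; have [pyx|] := eqVneq (par y) x;
      rewrite /= ?add0r ?addr0 //.
    - have := ct_lev ct xD; have := ct_lev ct yD; rewrite pxy pyx; lia.
    - by rewrite pxy (eq_sym y) (negPf (par_neq yD)) addr0.
    - by rewrite pyx (negPf (par_neq xD)) addr0.
rewrite (eq_bigr _ (fun x _ => E x)) !big_split /= -!big_mkcond /=.
congr (_ + (_ + _ + _)).
exact: sum_kids.
Qed.
End Sums.
End CliqueTree.

(** * Estimates for the edge weight *)

Section Weight.
Variable R : realType.
Local Open Scope ring_scope.
Local Notation f := (weight R).

Lemma weight_ge0 s : 0 <= f s. Proof. exact: sqrtr_ge0. Qed.

Lemma weight_sqr s : (2 <= s)%N -> f s ^+ 2 = 1 - 2 / s%:R.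
Proof.
move=> s2; rewrite sqr_sqrtr // subr_ge0 ler_pdivrMr ?mul1r ?ler_nat //.
by rewrite ltr0n (ltn_trans _ s2).
Qed.

Lemma inv_le s t : (0 < s)%N -> (s <= t)%N -> 2 / t%:R <= 2 / s%:R :> R.
Proof.
move=> s0 st; rewrite ler_wpM2l // lef_pV2 ?posrE ?ltr0n ?ler_nat //.
exact: leq_trans st.
Qed.

Lemma weight_le s t : (0 < s)%N -> (s <= t)%N -> f s <= f t.
Proof. by move=> s0 st; rewrite ler_wsqrtr // lerD2l lerN2 inv_le. Qed.

Lemma weight_lt s t : (2 <= s)%N -> (s < t)%N -> f s < f t.
Proof.
move=> s2 st; have s0 : (0 < s)%N := ltnW s2.
have t0 : (0 < t)%N := ltn_trans s0 st.
have lt_inv : 2 / t%:R < 2 / s%:R :> R.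
  by rewrite ltr_pM2l // ltf_pV2 ?posrE ?ltr0n ?ltr_nat.
rewrite ltr_sqrt ?ltrD2l ?ltrN2 // subr_gt0 ltr_pdivrMr ?ltr0n // mul1r ltr_nat.
exact: leq_ltn_trans st.
Qed.

Lemma weight_gt0 s : (2 < s)%N -> 0 < f s.
Proof. by move=> s2; apply: le_lt_trans (weight_ge0 2) (weight_lt _ s2). Qed.

Lemma weight_le1 s : f s <= 1.
Proof.
rewrite -[leRHS]sqrtr1 ler_wsqrtr // gerBl.
by rewrite divr_ge0 ?ler0n.
Qed.

Lemma weight_lb s (c : R) : (2 <= s)%N -> 0 <= c -> c ^+ 2 <= 1 - 2 / s%:R -> c <= f s.
Proof.
move=> s2 c0 H; rewrite -(@ler_pXn2r _ 2) ?nnegrE ?weight_ge0 //.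
by rewrite weight_sqr.
Qed.

Lemma weight_ub s (c : R) : (2 <= s)%N -> 0 <= c -> 1 - 2 / s%:R <= c ^+ 2 -> f s <= c.
Proof.
move=> s2 c0 H; rewrite -(@ler_pXn2r _ 2) ?nnegrE ?weight_ge0 //.
by rewrite weight_sqr.
Qed.

Lemma weight3_lb : 57 / 100 <= f 3. Proof. by apply: weight_lb => //; lra. Qed.
Lemma weight3_ub : f 3 <= 29 / 50. Proof. by apply: weight_ub => //; lra. Qed.
Lemma weight4_lb : 707 / 1000 <= f 4. Proof. by apply: weight_lb => //; lra. Qed.
Lemma weight4_ub : f 4 <= 708 / 1000. Proof. by apply: weight_ub => //; lra. Qed.
Lemma weight5_lb : 774 / 1000 <= f 5. Proof. by apply: weight_lb => //; lra. Qed.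
Lemma weight5_ub : f 5 <= 775 / 1000. Proof. by apply: weight_ub => //; lra. Qed.

(** Factor [f t ^+ 2 - f s ^+ 2]: both roots are at least [f 4], which exceeds [7 / 10]. *)
Lemma weight_incr s t : (4 <= s)%N -> (s <= t)%N ->
  7 / 5 * (f t - f s) <= 2 / s%:R - 2 / t%:R.
Proof.
move=> s4 st.
have Es : f s ^+ 2 = 1 - 2 / s%:R by apply: weight_sqr; lia.
have Et : f t ^+ 2 = 1 - 2 / t%:R by apply: weight_sqr; lia.
have fs : 7 / 10 <= f s.
  by apply: le_trans (weight_le _ s4) => //; have := weight4_lb; lra.
have fst : f s <= f t by apply: weight_le => //; lia.
by nra.
Qed.

Lemma weight_incr1 m : (3 <= m)%N ->
  7 / 10 * (f m.+2 - f m.+1) * (m.+1 * m.+2)%:R <= 1.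
Proof.
move=> m3; have := @weight_incr m.+1 m.+2 m3 (leqnSn _).
rewrite natrM -[m.+2%:R]natr1.
have : 4 <= m.+1%:R :> R by rewrite ler_nat.
move: (m.+1%:R) => x x4 H.
have E : (2 / x - 2 / (x + 1)) * (x * (x + 1)) = 2.
  by field; apply/andP; split; apply: lt0r_neq0; lra.
have p0 : 0 <= x * (x + 1) by nra.
have := ler_wpM2r p0 H; rewrite E => H'.
by rewrite -(ler_pM2l (ltr0n _ 2)) mulr1; apply: le_trans H'; lra.
Qed.

(** An instance of concavity: the left side is at most [1 / 14], the right side at least
    [127 / 1000]. *)
Lemma weight_gap3 m : (3 <= m)%N -> f m.+2 - f m.+1 < f 4 - f 3.
Proof.
move=> m3; have := weight_incr1 m3.
have : 20 <= (m.+1 * m.+2)%:R :> R by rewrite ler_nat; nia.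
have : f m.+1 <= f m.+2 by exact: weight_le.
have := weight4_lb; have := weight3_ub.
move: (f _) (f _) (f _) (f _) => a b c d; nra.
Qed.

(** This lets a bridge with both ends in large blocks be charged [f 4] plus twice the surcharge
    [f m.+1 - f 4]. *)
Lemma weight_gap4 m : (4 <= m)%N -> f m.+2 - f m.+1 <= f m.+1 - f 4.
Proof.
move=> m4; have := weight_incr1 (ltnW m4).
have : 30 <= (m.+1 * m.+2)%:R :> R by rewrite ler_nat; nia.
have : f m.+1 <= f m.+2 by exact: weight_le.
have : f 5 <= f m.+1 by exact: weight_le.
have := weight4_ub; have := weight5_lb.
move: (f _) (f _) (f _) (f _) => a b c d; nra.
Qed.

(** The two summands are at most [5 / 7] and [2 / 7], while [2 * f m.+1] is at least [2 * f 5 > 1].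
    The saving of one bridge thus pays for rounding all degrees up. *)
Lemma weight_gap_sum m : (4 <= m)%N ->
  (m * m.-1)%:R * (f (2 * m) - f (2 * m - 2)) + 2 * m.-1%:R * (f m.+2 - f m.+1)
   < 2 * f m.+1.
Proof.
move=> m4.
have H1 : 7 / 5 * ((m * m.-1)%:R * (f (2 * m) - f (2 * m - 2))) <= 1.
  have := @weight_incr (2 * m - 2) (2 * m) ltac:(lia) ltac:(lia).
  rewrite (_ : 2 * m - 2 = 2 * m.-1)%N; last by lia.
  rewrite !natrM.
  have : 3 <= m.-1%:R :> R by rewrite ler_nat; lia.
  have -> : m%:R = m.-1%:R + 1 :> R by rewrite natr1; congr (_%:R); lia.
  move: (m.-1%:R) => x x3.
  have -> : 2 / (2 * x) - 2 / (2 * (x + 1)) = (x * (x + 1))^-1.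
    by field; rewrite -?andbA; do ?[apply/andP; split]; apply: lt0r_neq0; lra.
  have p0 : 0 < x * (x + 1) by nra.
  move=> H; have := ler_wpM2r (ltW p0) H.
  by rewrite mulVf ?gt_eqF // => H'; apply: le_trans H'; lra.
have H2 : 7 * m.-1%:R * (f m.+2 - f m.+1) <= 1.
  have := weight_incr1 (ltnW m4).
  have : (10 * m.-1)%:R <= (m.+1 * m.+2)%:R :> R by rewrite ler_nat; nia.
  have : 0 <= f m.+2 - f m.+1 by rewrite subr_ge0; exact: weight_le.
  rewrite (natrM _ 10); move: (f _ - f _) (m.-1%:R) ((m.+1 * m.+2)%:R) => d x N d0 xN H.
  by have := ler_wpM2l d0 xN; lra.
have : f 5 <= f m.+1 by exact: weight_le.
have := weight5_lb.
by move: H1 H2; lra.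
Qed.
End Weight.

(** * Optimising the number of paths and of long paths *)

Section PathValue.
Variable R : realType.
Local Open Scope ring_scope.
Local Notation f := (weight R).

(** The weight sum over ordered pairs of a clique of order [m] in which [q] vertices have degree [m]
    and the others [m - 1]. *)
Definition clique_value (m q : nat) : R :=
  q%:R * (q%:R - 1) * f (2 * m) + 2 * q%:R * (m%:R - q%:R) * f (2 * m - 1) +
  (m%:R - q%:R) * (m%:R - q%:R - 1) * f (2 * m - 2).

(* Twice the ABS index of a clique of order [m] with paths of total length [p]
   attached to [q] of its vertices, [s] of these paths having length at
   least 2. *)
Definition path_value (m p q s : nat) : R :=
  clique_value m q +
  2 * ((q%:R - s%:R) * f m.+1 + s%:R * f m.+2 + s%:R * f 3 +
       (p%:R - q%:R - s%:R) * f 4).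


(** Abel summation: with [F2], [F1], [F0] the three weights, the value is [q * (q - 1) * (F2 - F1) +
    q * (2 * m - q - 1) * (F1 - F0) + m * (m - 1) * F0], and both coefficients grow with [q]. *)
Lemma clique_value_mono m q r : (2 <= m)%N -> (q <= r)%N -> (r <= m)%N ->
  clique_value m q <= clique_value m r.
Proof.
move=> m2 qr rm; rewrite /clique_value.
have H1 : f (2 * m - 2) <= f (2 * m - 1) by apply: weight_le; lia.
have H2 : f (2 * m - 1) <= f (2 * m) by apply: weight_le; lia.
have K1 : (q * (q - 1))%:R <= (r * (r - 1))%:R :> R by rewrite ler_nat; nia.
have K2 : (q * (2 * m - q - 1))%:R <= (r * (2 * m - r - 1))%:R :> R.
  rewrite ler_nat; have [->//|qr'] := eqVneq q r.
  have -> : (2 * m - q - 1 = (2 * m - r - 1) + (r - q))%N by lia.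
  have -> : r = (q + (r - q))%N by lia.
  have : (r - q <= 2 * m - r - 1 + (r - q) - q)%N by lia.
  nia.
have E k : (k <= m)%N -> (k * (k - 1))%:R = k%:R * (k%:R - 1) :> R.
  case: k => [|k] _; first by rewrite !mul0r.
  by rewrite natrM natrB.
have E' k : (k <= m)%N -> (k * (2 * m - k - 1))%:R = k%:R * (2 * m%:R - k%:R - 1) :> R.
  by move=> km; rewrite natrM !natrB ?natrM //; lia.
have qm := leq_trans qr rm.
move: K1 K2; rewrite !E ?E' //.
move: (f (2 * m)) (f (2 * m - 1)) (f (2 * m - 2)) H1 H2 => F2 F1 F0 H1 H2 K1 K2.
have := mulr_ge0 (eqbRL (subr_ge0 _ _) H2) (eqbRL (subr_ge0 _ _) K1).
have := mulr_ge0 (eqbRL (subr_ge0 _ _) H1) (eqbRL (subr_ge0 _ _) K2).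
by lra.
Qed.

Lemma clique_value_lt m q : (2 <= m)%N -> (q < m)%N ->
  clique_value m q < clique_value m m.
Proof.
move=> m2 qm; apply: (le_lt_trans (@clique_value_mono m q m.-1 m2 _ _)); try lia.
rewrite /clique_value.
have -> : m%:R = m.-1%:R + 1 :> R by rewrite natr1; congr (_%:R); lia.
have H : f (2 * m - 1) < f (2 * m) by apply: weight_lt; lia.
have K : 1 <= m.-1%:R :> R by rewrite ler1n; lia.
by nra.
Qed.

(** The clique part is monotone in [q]. Half the loss in the path part is [(p - q - s) * (f m.+1 - f
    4) + s * (2 * f m.+1 - f m.+2 - f 3)] if [p <= m], and [(m - q) * (f m.+1 - f 4) + (s - 1) * (f
    m.+1 - f m.+2 - f 3 + f 4)] if [m < p]. For [m >= 3] the last factors are positive by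
    [weight_gap3]. *)
Lemma path_value_max m p q s : (2 <= m)%N -> (s <= q)%N -> (q <= m)%N ->
  (q + s <= p)%N -> ((q < p)%N -> (0 < s)%N) ->
  (m = 2 -> (0 < p)%N -> (s < q)%N) ->
  (q != minn m p) || (s != (m < p)%N) ->
  path_value m p q s < path_value m p (minn m p) (m < p)%N.
Proof.
move=> m2 sq qm qsp s_gt0 mE2 neq.
have ABmon : f m.+1 <= f m.+2 by exact: weight_le.
have [pm|pm] := leqP p m.
  have Emin : minn m p = p by lia.
  rewrite Emin /= in neq *.
  have qp : (q < p)%N.
    by rewrite ltn_neqAle -Emin; move: neq; rewrite -[in X in X -> _]Emin; lia.
  have s1 := s_gt0 qp.
  (* At [m = 2] the gap inequality degenerates to an equality, but there [0 < s < q < p <= m] is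
     impossible. *)
  have m3 : (3 <= m)%N.
    by rewrite ltn_neqAle m2 andbT; apply/eqP => E; have := mE2 (esym E); lia.
  have Hc := @clique_value_mono m q p m2 (ltnW qp) pm.
  have gap := @weight_gap3 R m m3.
  have A4 : f 4 <= f m.+1 by exact: weight_le.
  have T : 0 <= (p - q - s)%:R * (f m.+1 - f 4) by rewrite mulr_ge0 // subr_ge0.
  have T' : 0 < s%:R * (2 * f m.+1 - f m.+2 - f 3) by rewrite mulr_gt0 ?ltr0n //; lra.
  rewrite /path_value; move: T; rewrite !natrB; try lia.
  by move: Hc T'; move: (clique_value _ _) (clique_value _ _) => c1 c2; lra.
have Emin : minn m p = m by lia.
rewrite Emin /= in neq *.
have s1 : (0 < s)%N by apply: s_gt0; lia.
rewrite /path_value.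
(* For [m = 2], [0 < s < q <= m] leaves only the optimal pair [q = 2], [s = 1]. *)
have [E2|m3] : m = 2 \/ (3 <= m)%N by lia.
  have sq' := mE2 E2 ltac:(lia); exfalso; lia.
have gap := @weight_gap3 R m m3.
have A4 : f 4 <= f m.+1 by exact: weight_le.
have T : 0 <= (m - q)%:R * (f m.+1 - f 4) by rewrite mulr_ge0 // subr_ge0.
have gap' : 0 < f m.+1 - f m.+2 - f 3 + f 4 by lra.
have Es : s%:R = s.-1%:R + 1 :> R by rewrite natr1; congr (_%:R); lia.
rewrite Es; rewrite natrB // in T.
have [qE|qE] := eqVneq q m.
  have T' : 0 < s.-1%:R * (f m.+1 - f m.+2 - f 3 + f 4).
    by rewrite mulr_gt0 ?ltr0n //; lia.
  by rewrite qE in T *; move: (clique_value _ _) => c1; lra.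
have T' : 0 <= s.-1%:R * (f m.+1 - f m.+2 - f 3 + f 4) by rewrite mulr_ge0 // ltW.
have qm' : (q < m)%N by lia.
have Hc := clique_value_lt m2 qm'.
by move: Hc; move: (clique_value _ _) (clique_value _ _) => c1 c2; lra.
Qed.
End PathValue.

(** * A clique with pendant paths *)

Lemma sumr_setDI (R : nmodType) (T : finType) (A B : {set T}) (F : T -> R) :
  (\sum_(x in A) F x = \sum_(x in A :&: B) F x + \sum_(x in A :\: B) F x)%R.
Proof. by rewrite (big_setID B). Qed.

Section Paths.
Variables (R : realType) (G : sgraph) (D : {set G}) (par : G -> G) (lev : G -> nat).
Hypothesis ct : clique_tree D par lev.
Variables (m p : nat).
Hypothesis cardD : #|D| = m.
Hypothesis cardG : #|G| = m + p.
Hypothesis nkids_le1 : forall v, nkids D par v <= 1.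

Local Notation nk := (nkids D par).

(* With at most one child per vertex, [heads] are the vertices of [D] carrying a
   path, and [long_kids] marks the paths of length at least 2. *)
Definition long_kids : {set G} :=
  [set x | [&& x \notin D, par x \in D & nk x == 1]].
Definition heads : {set G} := [set v in D | nk v == 1].

Lemma nk01 v : nk v = (nk v == 1) :> nat.
Proof. by have := nkids_le1 v; case: (nk v) => [|[|]]. Qed.

Lemma card_sum1 (A : {set G}) : \sum_(v in A) nk v = #|[set v in A | nk v == 1]|.
Proof.
rewrite -sum1_card (eq_bigr (fun v => if nk v == 1 then 1 else 0)); last first.
  by move=> v _; rewrite [LHS]nk01; case: (_ == _).
by rewrite -big_mkcondr; apply: eq_bigl => v; rewrite inE.
Qed.

Lemma card_outside : #|~: D| = p.
Proof. by rewrite cardsCs setCK cardG cardD addKn. Qed.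

Lemma card_kids_of (A : {set G}) :
  #|[set x | (x \notin D) && (par x \in A)]| = \sum_(v in A) nk v.
Proof.
have -> : \sum_(v in A) nk v = \sum_v nk v * (v \in A).
  by rewrite big_mkcond; apply: eq_bigr => v _; case: (v \in A); rewrite ?muln1 ?muln0.
rewrite -(sum_par D par (fun v => (v \in A) : nat)) -sum1dep_card big_mkcondr /=.
by apply: eq_bigr => x _; case: (_ \in _).
Qed.

Lemma card_heads_long :
  [/\ #|long_kids| <= #|heads|, #|heads| <= m, #|heads| + #|long_kids| <= p &
      #|heads| < p -> 0 < #|long_kids|].
Proof.
have kidsD := card_kids_of D; rewrite card_sum1 -/heads in kidsD.
have nk_out : \sum_(v in ~: D) nk v + #|heads| = p.
  have := sum_nkids D par; rewrite cardG (bigID [in D]) /= card_sum1 -/heads cardD.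
  have -> : \sum_(v in ~: D) nk v = \sum_(i | i \notin D) nk i.
    by apply: eq_bigl => v; rewrite inE.
  lia.
split.
- rewrite -kidsD; apply/subset_leq_card/subsetP => x.
  by rewrite !inE => /and3P[-> ->].
- by rewrite -cardD; apply/subset_leq_card/subsetP => x; rewrite inE => /andP[].
- rewrite -nk_out addnC leq_add2r card_sum1.
  by apply/subset_leq_card/subsetP => x; rewrite !inE => /and3P[-> _ ->].
move=> lt_p.
have [x xD pD] : exists2 x, x \notin D & par x \notin D.
  have : [set x | (x \notin D) && (par x \in D)] \proper ~: D.
    rewrite properEcard kidsD card_outside lt_p andbT.
    by apply/subsetP => x; rewrite !inE => /andP[].
  case/properP=> _ [x]; rewrite !inE => xD; rewrite xD /= => pD.
  by exists x.
(* Climb from a vertex outside [D] that has a child: its ancestor of level 1 has a child too, hence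
   lies in [long_kids]. *)
suff H k : forall y, lev y = k.+1 -> 0 < nk y -> 0 < #|long_kids|.
  apply: (H (lev (par x)).-1 (par x)).
    by rewrite prednK // lt0n (ct_lev0 ct).
  by apply/card_gt0P; exists x; rewrite kidsE xD eqxx.
elim: k => [|k IH] y ly ky.
  have yD : y \notin D by rewrite -(ct_lev0 ct) ly.
  apply/card_gt0P; exists y; rewrite inE yD -(ct_lev0 ct) /=.
  have := ct_lev ct yD; rewrite ly => -[<-] /=.
  by rewrite eqn_leq nkids_le1.
have yD : y \notin D by rewrite -(ct_lev0 ct) ly.
have := ct_lev ct yD; rewrite ly => -[lp].
apply: (IH (par y)) => //.
by apply/card_gt0P; exists y; rewrite kidsE yD eqxx.
Qed.

Local Open Scope ring_scope.
Local Notation f := (weight R).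

Lemma sum_clique : (2 <= m)%N ->
  \sum_(x in D) \sum_(y in D | y != x) f (deg x + deg y)%N =
  clique_value R m #|heads|.
Proof.
move=> m2; set q := #|heads|.
have [_ qm _ _] := card_heads_long.
have degD x : x \in D -> deg x = (m.-1 + (x \in heads))%N.
  by move=> xD; rewrite (deg_block ct xD) cardD [nkids _ _ _]nk01 inE xD.
have DI : D :&: heads = heads.
  by apply/setIidPr/subsetP => x; rewrite inE => /andP[].
have cardDD : #|D :\: heads| = (m - q)%N by rewrite cardsD DI cardD.
have inner x : x \in D -> \sum_(y in D | y != x) f (deg x + deg y)%N =
    (\sum_(y in D) f (deg x + deg y)%N) - f (deg x + deg x)%N.
  by move=> xD; rewrite [in RHS](bigD1 x) //= addrC addrK.
rewrite (eq_bigr _ inner) sumrB.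
have full x : x \in D -> \sum_(y in D) f (deg x + deg y)%N =
    q%:R * f (m.-1 + (x \in heads) + m)%N +
    (m%:R - q%:R) * f (m.-1 + (x \in heads) + m.-1)%N.
  move=> xD; rewrite (sumr_setDI _ heads) DI -natrB // -cardDD.
  rewrite !mulr_natl -!sumr_const; congr (_ + _); apply: eq_bigr => y.
    move=> yh; have yD : y \in D by move: yh; rewrite inE => /andP[].
    by rewrite !degD // yh; congr (f _); lia.
  by rewrite inE => /andP[yh yD]; rewrite !degD // (negPf yh); congr (f _); lia.
rewrite (eq_bigr _ full) (sumr_setDI _ heads) DI.
rewrite [X in _ - X](sumr_setDI _ heads) DI.
have s1 (F : G -> R) (c : R) : (forall x, x \in heads -> F x = c) ->
   \sum_(x in heads) F x = q%:R * c.
  by move=> H; rewrite (eq_bigr _ H) sumr_const mulr_natl.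
have s0 (F : G -> R) (c : R) : (forall x, x \in D :\: heads -> F x = c) ->
   \sum_(x in D :\: heads) F x = (m%:R - q%:R) * c.
  by move=> H; rewrite (eq_bigr _ H) sumr_const -natrB // mulr_natl cardDD.
have hD x : x \in heads -> x \in D by rewrite inE => /andP[].
have e2 : (m.-1 + 1 + m = 2 * m)%N by lia.
have e1 : (m.-1 + 1 + m.-1 = 2 * m - 1)%N by lia.
have e1' : (m.-1 + 0 + m = 2 * m - 1)%N by lia.
have e0 : (m.-1 + 0 + m.-1 = 2 * m - 2)%N by lia.
rewrite (s1 _ (q%:R * f (2 * m) + (m%:R - q%:R) * f (2 * m - 1))); last first.
  by move=> x xh; rewrite xh e2 e1.
rewrite (s0 _ (q%:R * f (2 * m - 1) + (m%:R - q%:R) * f (2 * m - 2))); last first.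
  by move=> x; rewrite inE => /andP[/negPf-> _]; rewrite e1' e0.
rewrite (s1 _ (f (2 * m))); last first.
  by move=> x xh; rewrite !degD ?hD // xh; congr (f _); lia.
rewrite (s0 _ (f (2 * m - 2))); last first.
  move=> x; rewrite inE => /andP[xh xD].
  by rewrite !degD // (negPf xh); congr (f _); lia.
by rewrite /clique_value; ring.
Qed.

Lemma sum_paths : (2 <= m)%N ->
  \sum_(x | x \notin D) f (deg x + deg (par x))%N =
  (#|heads|%:R - #|long_kids|%:R) * f m.+1 + #|long_kids|%:R * f m.+2 +
  #|long_kids|%:R * f 3 + (p%:R - #|heads|%:R - #|long_kids|%:R) * f 4.
Proof.
move=> m2; have [sq qm qsp _] := card_heads_long.
have nkp x : x \notin D -> nk (par x) = 1%N.
  move=> xD; apply/eqP; rewrite eqn_leq nkids_le1.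
  by apply/card_gt0P; exists x; rewrite kidsE xD eqxx.
have degx x : x \notin D -> deg x = (nk x == 1%N).+1.
  by move=> xD; rewrite (deg_out ct xD) nkp // -nk01.
have degp x : x \notin D -> deg (par x) = if par x \in D then m else 2.
  move=> xD; case: ifPn => pD.
    by rewrite (deg_block ct pD) nkp // cardD; lia.
  by rewrite (deg_out ct pD) !nkp.
(* For [x] outside [D], [par x] has degree [m] if [x] is in [K] and 2 otherwise, and [x] has degree
   2 if it is in [N] and 1 otherwise. This gives the four weights. *)
pose K := [set x | (x \notin D) && (par x \in D)].
pose N := [set x | (x \notin D) && (nk x == 1%N)].
have cK : #|K| = #|heads| by rewrite /K card_kids_of card_sum1.
have cN : (#|N| + #|heads| = p)%N.
  have := sum_nkids D par; rewrite cardG (bigID [in D]) /= card_sum1 -/heads cardD.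
  have -> : (\sum_(i | i \notin D) nk i = \sum_(i in ~: D) nk i)%N.
    by apply: eq_bigl => v; rewrite inE.
  rewrite card_sum1 (_ : [set v in ~: D | nk v == 1%N] = N); last first.
    by apply/setP => x; rewrite !inE.
  lia.
have KN : K :&: N = long_kids.
  by apply/setP => x; rewrite !inE; case: (x \in D) => //=.
have KD : K \subset ~: D by apply/subsetP => x; rewrite !inE => /andP[].
have ND : N \subset ~: D by apply/subsetP => x; rewrite !inE => /andP[].
have step (A : {set G}) (c : R) (F : G -> R) :
    (forall x, x \in A -> F x = c) -> \sum_(x in A) F x = #|A|%:R * c.
  by move=> H; rewrite (eq_bigr _ H) sumr_const mulr_natl.
rewrite (eq_bigl [in ~: D]); last by move=> x; rewrite inE.
rewrite (sumr_setDI _ K) (setIidPr KD) (sumr_setDI K N) KN.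
rewrite (sumr_setDI (_ :\: K) N).
rewrite (step long_kids (f m.+2)); last first.
  move=> x; rewrite inE => /and3P[xD pD kx].
  by rewrite degx // degp // pD kx.
rewrite (step (K :\: N) (f m.+1)); last first.
  move=> x; rewrite !inE => /andP[H /andP[xD pD]].
  by move: H; rewrite xD /= => /negPf H; rewrite degx // degp // pD H.
rewrite (step ((~: D :\: K) :&: N) (f 4)); last first.
  move=> x; rewrite !inE => /andP[/andP[H xD] /andP[_ kx]].
  by move: H; rewrite xD /= => /negPf H; rewrite degx // degp // H kx.
rewrite (step ((~: D :\: K) :\: N) (f 3)); last first.
  move=> x; rewrite !inE => /andP[H' /andP[H xD]].
  move: H H'; rewrite xD /= => /negPf H /negPf H'.
  by rewrite degx // degp // H H'.
have c1 : #|K :\: N| = (#|heads| - #|long_kids|)%N by rewrite cardsD KN cK.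
have c2 : #|(~: D :\: K) :&: N| = (p - #|heads| - #|long_kids|)%N.
  have -> : (~: D :\: K) :&: N = N :\: K.
    by apply/setP => x; rewrite !inE; case: (x \in D); rewrite /= ?andbF //= ?andbT.
  rewrite cardsD setIC KN; lia.
have c3 : #|(~: D :\: K) :\: N| = #|long_kids|.
  rewrite cardsD c2 cardsD (setIidPr KD) card_outside cK; lia.
rewrite c1 c2 c3 !natrB //; first ring; lia.
Qed.

Lemma ABS_paths : (2 <= m)%N ->
  2 * ABS R G = path_value R m p #|heads| #|long_kids|.
Proof.
move=> m2; rewrite ABS_ordered (sum_adj ct) sum_clique // /path_value.
rewrite -sum_paths // mulr_sumr [X in _ + (_ + X)]big1 ?addr0.
  by congr (_ + _); apply: eq_bigr => x _; rewrite (addnC (deg (par x))) mulr_natl mulr2n.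
move=> x xD; rewrite big_pred0 // => y; apply/negbTE/negP => /and3P[yD yx /eqP pxy].
have := nkids_le1 (par x); rewrite leqNgt => /negP; apply.
apply/card_gt1P; exists x, y; rewrite !kidsE xD yD -pxy eqxx.
by split=> //; rewrite eq_sym.
Qed.
End Paths.

(** * At least two large blocks *)

Section ManyBlocks.
Variables (R : realType) (G : sgraph) (D : {set G}) (par : G -> G) (lev : G -> nat).
Hypothesis ct : clique_tree D par lev.
Variables (m p : nat).
Local Notation nk := (nkids D par).
Local Notation a := #|D|.
Hypothesis card_cut : #|[set v | 0 < nk v]| = p.
Hypothesis cardG : #|G| = m + p.
Hypothesis nk_lt : forall v, nk v < a.
Hypothesis lt_a_m : a < m.

(** Such a [v] and its children form a block of order at least 3, so this counts the large blocks
    other than [D]. *)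
Definition branching : nat := #|[set v | 1 < nk v]|.
Local Notation K := branching.

(** Take one away from each of the [p] positive terms of [sum_nkids]; the truncated predecessor
    leaves childless vertices at 0. *)
Lemma sum_excess : \sum_v (nk v).-1 + a = m.
Proof.
have := sum_nkids D par; rewrite cardG -card_cut -sum1dep_card.
have -> : \sum_v nk v = \sum_v ((nk v).-1 + (if 0 < nk v then 1 else 0))%N.
  by apply: eq_bigr => v _; case: (nk v) => //= k; rewrite addn1.
by rewrite big_split /= -big_mkcond addnAC => /addIn.
Qed.

Lemma excess1 v : (nk v).-1 + a <= m.
Proof. by rewrite -sum_excess leq_add2r (bigD1 v) //= leq_addr. Qed.

Lemma excess2 v u : v != u -> (nk v).-1 + (nk u).-1 + a <= m.
Proof.
move=> vu; rewrite -sum_excess leq_add2r (bigD1 v) //= leq_add2l.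
by rewrite (bigD1 u) 1?eq_sym //= leq_addr.
Qed.

Lemma card_bool (P : pred G) : #|[set v | P v]| = \sum_v P v.
Proof. by rewrite -sum1dep_card big_mkcond; apply: eq_bigr => v _; case: (P v). Qed.

Lemma branching_le : K <= m - a.
Proof.
rewrite /K card_bool -sum_excess addnK; apply: leq_sum => v _.
by case: (nk v) => [|[|]].
Qed.

Lemma branching_gt0 : 0 < K.
Proof.
rewrite lt0n; apply/eqP => /eqP; rewrite cards_eq0 => /eqP E.
have := sum_excess; rewrite big1 => [|v _].
  by rewrite add0n => H; move: lt_a_m; rewrite H ltnn.
by have := in_set0 v; rewrite -E inE; case: (nk v) => [|[|]].
Qed.

Lemma card_single : #|[set v | nk v == 1]| + K = p.
Proof.
rewrite -card_cut /K !card_bool -big_split; apply: eq_bigr => v _ /=.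
by case: (nk v) => [|[|]].
Qed.

Lemma a_ge3 : 3 <= a.
Proof.
have /card_gt0P[v] := branching_gt0; rewrite inE => H.
exact: leq_ltn_trans (nk_lt v).
Qed.

Lemma deg_le (v : G) : deg v <= m.
Proof.
have := a_ge3; have := lt_a_m; have [vD|vD] := boolP (v \in D).
  by rewrite (deg_block ct vD); have := excess1 v; clear; lia.
rewrite (deg_out ct vD); have := excess2 (par_neq ct vD).
have := nk_lt v; have := nk_lt (par v).
by move: (nk v) (nk (par v)); clear; move=> x y; case: x => [|x] /=; lia.
Qed.

(** The scrutinee counts the ends of the bridge lying in a block of order at least 3: [x] through
    its children, [par x] through [D] or through its siblings. *)
Lemma deg_bridge (x : G) : x \notin D -> nk (par x) = 1 ->
  deg x + deg (par x) <= m.+2 /\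
  deg x + deg (par x) <= match (1 < nk x) + ((par x \in D) || (1 < nk (par (par x)))) with
    | 0 => 4 | 1 => m.+1 | _ => m.+2 end.
Proof.
move=> xD kp; rewrite (deg_out ct xD) kp.
have := a_ge3; have := lt_a_m; have := excess1 x; have := nk_lt x.
have [pD|pD] := boolP (par x \in D).
  rewrite (deg_block ct pD) kp /=.
  by move: (nk x); clear; case=> [|[|x]] /=; lia.
rewrite (deg_out ct pD) kp /=.
have xpp : x != par (par x).
  by apply/eqP => E; have := ct_lev ct xD; have := ct_lev ct pD; rewrite -E; clear; lia.
have := excess2 xpp; have := nk_lt (par (par x)).
by move: (nk x) (nk (par (par x))); clear; case=> [|[|x]] [|[|y]] /=; lia.
Qed.

(* The block formed by [v] and its [nk v] children has [nk v * (nk v).+1]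
   ordered adjacent pairs; blocks of order 2 are left out. *)
Definition block_pairs : nat :=
  a * a.-1 + \sum_v nk v * ((1 < nk v) * (nk v).+1).

(** Since [m * (m - 1) - a * (a - 1) = (m - a) * (m - 2) + (m - a) * (a + 1)], only the blocks other
    than [D] need a bound. *)
Lemma block_pairs_le : block_pairs + (m - a) * (m - 2) <= m * m.-1 + 2 * K.
Proof.
(* With [k = nk v >= 2], [k * (k + 1) - 2 = (k - 1) * (k + 2)], at most [(k - 1) * (a + 1)] because
   [k < a]. *)
have H : \sum_v nk v * ((1 < nk v) * (nk v).+1) <= (a.+1) * (m - a) + 2 * K.
  rewrite -{1}sum_excess addnK /K card_bool !big_distrr -big_split /=.
  apply: leq_sum => v _; have := nk_lt v.
  by case: (nk v) => [|[|k]] //= Hk; rewrite !mul1n; nia.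
rewrite /block_pairs; have := lt_a_m; have := a_ge3; move: H.
move: (\sum_v _) => S; move: K a => k b; clear; move=> H b3 bm.
have -> : m = (b + (m - b))%N by lia.
by move: H; move: (m - b)%N => e; rewrite addKn; case: b b3 bm => // b _ _ /=; nia.
Qed.

Lemma sum_bridges (g : G -> nat) :
  \sum_(x | (x \notin D) && (nk (par x) == 1)) g (par x) =
  \sum_(v | nk v == 1) g v.
Proof.
rewrite big_mkcondr /= (sum_par D par (fun v => if nk v == 1 then g v else 0)).
rewrite [RHS]big_mkcond; apply: eq_bigr => v _.
by case: eqP => [->|_]; rewrite ?mul1n ?muln0.
Qed.

Lemma card_bridges :
  #|[set x | (x \notin D) && (nk (par x) == 1)]| = #|[set v | nk v == 1]|.
Proof. by rewrite -!sum1dep_card (sum_bridges (fun=> 1)). Qed.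

(** Lower ends with several children number at most [K]. Upper ends lie in [D] or among the children
    of branching vertices, which makes at most [a] plus the total excess plus [K], that is
    [m + K]. *)
Lemma sum_bridge_ends :
  \sum_(x | (x \notin D) && (nk (par x) == 1))
     ((1 < nk x) + ((par x \in D) || (1 < nk (par (par x))))) <= m + 2 * K.
Proof.
rewrite big_split /=.
rewrite (sum_bridges (fun c => (c \in D) || (1 < nk (par c)))).
have H1 : \sum_(x | (x \notin D) && (nk (par x) == 1)) (1 < nk x) <= K.
  rewrite /K card_bool big_mkcond /=; apply: leq_sum => x _.
  by case: (_ && _).
suff H2 : \sum_(v | nk v == 1) ((v \in D) || (1 < nk (par v))) <= m + K by lia.
apply: (@leq_trans (\sum_v ((v \in D) || (1 < nk (par v))))).
  by rewrite [leqLHS]big_mkcond; apply: leq_sum => v _; case: (_ == _).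
rewrite (bigID [in D]) /=.
rewrite (eq_bigr (fun=> 1)); last by move=> v ->.
rewrite sum1_card (eq_bigr (fun v => (1 < nk (par v)) : nat)); last first.
  by move=> v /negPf->.
rewrite (sum_par D par (fun c => (1 < nk c) : nat)) -sum_excess.
rewrite [leqRHS]addnAC [leqLHS]addnC leq_add2r.
rewrite /K card_bool -big_split; apply: leq_sum => v _ /=.
by case: (nk v) => [|[|]] //= k; lia.
Qed.

Local Open Scope ring_scope.
Local Notation f := (weight R).

Lemma ABS_blocks (h : G -> R) :
  (forall x, x \notin D -> nk (par x) = 1%N ->
     f (deg x + deg (par x))%N <= h x) ->
  2 * ABS R G <= block_pairs%:R * f (2 * m) +
    2 * \sum_(x | (x \notin D) && (nk (par x) == 1%N)) h x.
Proof.
move=> Hh; rewrite ABS_ordered (sum_adj ct).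
have fF (x y : G) : adj x y -> f (deg x + deg y)%N <= f (2 * m).
  move=> xy; apply: weight_le; last by rewrite mul2n -addnn; apply: leq_add; exact: deg_le.
  by rewrite addn_gt0 card_gt0; apply/orP; left; apply/set0Pn; exists y; rewrite inE.
rewrite /block_pairs natrD mulrDl -addrA; apply: lerD.
  have -> : (a * a.-1)%:R * f (2 * m) =
      \sum_(x in D) \sum_(y in D | y != x) f (2 * m).
    rewrite (eq_bigr (fun=> a.-1%:R * f (2 * m))) ?sumr_const => [|x xD].
      by rewrite natrM -mulrA mulr_natl.
    rewrite sumr_const mulr_natl (cardsD1 x) xD; congr (_ *+ _).
    by apply: eq_card => y; rewrite !inE andbC.
  apply: ler_sum => x xD; apply: ler_sum => y /andP[yD yx].
  by apply: fF; rewrite (ct_adj ct) eq_sym yx xD yD.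
rewrite -big_split /=.
have -> : (\sum_v nk v * ((1 < nk v) * (nk v).+1))%:R * f (2 * m) =
   \sum_(x | x \notin D) ((1 < nk (par x))%N * (nk (par x)).+1)%:R * f (2 * m).
  by rewrite -mulr_suml -natr_sum (sum_par D par (fun c => (1 < nk c) * (nk c).+1)%N).
rewrite mulr_sumr big_mkcondr /= -big_split /=; apply: ler_sum => x xD.
have kp : (0 < nk (par x))%N by apply/card_gt0P; exists x; rewrite kidsE xD eqxx.
have cs : #|[pred y | [&& y \notin D, y != x & par x == par y]]| = (nk (par x)).-1.
  rewrite /nkids (cardsD1 x) kidsE xD eqxx /=; apply: eq_card => y.
  by rewrite !inE andbCA (eq_sym (par y)).
have [k1|k1] := eqVneq (nk (par x)) 1%N.
  rewrite k1 mul0n mul0r add0r big_pred0 ?addr0.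
    have := Hh x xD k1; rewrite (addnC (deg (par x))); lra.
  by move=> y; rewrite k1 in cs; have := card0_eq cs y; rewrite inE.
have k2 : (1 < nk (par x))%N by lia.
have xp : adj x (par x).
  by rewrite (ct_adj ct) eq_sym (par_neq ct xD) xD eqxx /= orbT.
rewrite k2 mul1n addr0.
(* Each [x] is charged the two ordered pairs with its parent and one pair for each sibling. *)
have -> : (nk (par x)).+1 = (2 + (nk (par x)).-1)%N by lia.
rewrite natrD mulrDl; apply: lerD.
  have := fF _ _ xp; rewrite (addnC (deg (par x))); lra.
rewrite -cs mulr_natl -sumr_const; apply: ler_sum => y /and3P[yD yx pxy].
by apply: fF; rewrite (ct_adj ct) eq_sym yx xD yD pxy /= !orbT.
Qed.

(** As [K > 0], there are at most [p - 1] bridges, and block pairs do not exceed [m * m.-1].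
    Bounding bridges by [f m.+2] and pairs by [f (2 * m)] is then compensated by the missing
    bridge. *)
Lemma ABS_blocks_few : (p <= m)%N ->
  2 * ABS R G < 2 * p%:R * f m.+1 + (m * m.-1)%:R * f (2 * m - 2).
Proof.
move=> pm; have := lt_a_m; have := a_ge3 => a3 am.
have m4 : (4 <= m)%N by exact: leq_ltn_trans am.
have H1 := @ABS_blocks (fun=> f m.+2).
apply: le_lt_trans (H1 _) _.
  by move=> x xD kp; apply: weight_le; [|by case: (deg_bridge xD kp)];
     rewrite (deg_out ct xD) kp.
rewrite sumr_const -[#|_|]/(#|mem (fun x => (x \notin D) && (nk (par x) == 1%N))|).
have -> : #|(fun x => (x \notin D) && (nk (par x) == 1%N))| = #|[set v | nk v == 1%N]|.
  by rewrite -card_bridges; apply: eq_card => x; rewrite inE.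
have := card_single; have := branching_gt0; have := block_pairs_le.
have := branching_le.
move: K #|[set v | nk v == 1%N]| => k b kle Hb k0 bk.
have Npairs : (block_pairs <= m * m.-1)%N.
  have : (2 * k <= (m - a) * (m - 2))%N by nia.
  lia.
have gap := @weight_gap_sum R m m4.
have L1 : (block_pairs%:R : R) * f (2 * m) <= (m * m.-1)%:R * f (2 * m).
  by rewrite ler_wpM2r ?weight_ge0 // ler_nat.
have d0 : 0 <= f m.+2 - f m.+1 by rewrite subr_ge0; exact: weight_le.
have L2 : b%:R * (f m.+2 - f m.+1) <= m.-1%:R * (f m.+2 - f m.+1).
  by rewrite ler_wpM2r // ler_nat; lia.
have L3 : (b%:R + 1) * f m.+1 <= p%:R * f m.+1.
  by rewrite ler_wpM2r ?weight_ge0 // natr1 ler_nat; lia.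
by rewrite -mulr_natl; lra.
Qed.

Lemma ABS_blocks_many : (m < p)%N ->
  2 * ABS R G < path_value R m p m 1.
Proof.
move=> mp; have := lt_a_m; have := a_ge3 => a3 am.
have m4 : (4 <= m)%N by exact: leq_ltn_trans am.
have A4 : f 4 <= f m.+1 by apply: weight_le => //; lia.
(* A bridge is charged [f 4] and one surcharge for each end in a large block; [weight_gap4] covers
   the case of two such ends. *)
have H1 := @ABS_blocks (fun x => f 4 + (f m.+1 - f 4) *
  ((1 < nk x) + ((par x \in D) || (1 < nk (par (par x)))))%N%:R).
apply: le_lt_trans (H1 _) _.
  move=> x xD kp; have [_] := deg_bridge xD kp.
  have pos : (0 < deg x + deg (par x))%N by rewrite (deg_out ct xD) kp.
  have gap := @weight_gap4 R m m4.
  case: (1 < nk x)%N; case: (_ || _) => /= /(weight_le R pos); lra.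
rewrite big_split /= sumr_const -mulr_sumr -natr_sum.
have -> : #|(fun x => (x \notin D) && (nk (par x) == 1%N))| = #|[set v | nk v == 1%N]|.
  by rewrite -card_bridges; apply: eq_card => x; rewrite inE.
have := sum_bridge_ends; have := card_single; have := branching_gt0.
have := block_pairs_le; have := branching_le.
move: (\sum_(x | _) _)%N => T.
move: K #|[set v | nk v == 1%N]| => k b kle Hb k0 bk TK.
(* [k <= m - a], and [m - 2] is at least 3 when [m > 4], which spares [k] ordered pairs; at [m = 4]
   nothing is spared. *)
have Npairs : (block_pairs + (4 < m) * k <= m * m.-1)%N.
  move: (block_pairs) (m * m.-1)%N Hb kle am m4 => N M.
  move: (a) => c; clear => Hb kc cm m4.
  have : ((2 + (4 < m)) * k <= (m - c) * (m - 2))%N by case: ltnP; nia.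
  by lia.
have m0 : (0 < m)%N by exact: leq_trans m4.
have LT : (f m.+1 - f 4) * T%:R <= (f m.+1 - f 4) * (m%:R + 2 * k%:R).
  by rewrite ler_wpM2l ?subr_ge0 // -natrM -natrD ler_nat.
have F0 : 7 / 10 <= f (2 * m).
  have m42 : (4 <= 2 * m)%N by exact: leq_trans m4 (leq_pmull _ _).
  by apply: le_trans (weight_le R _ m42) => //; have := weight4_lb R; lra.
have w4 := weight4_lb R; have w4' := weight4_ub R; have w3 := weight3_lb R.
have w12 : f m.+1 <= f m.+2 by exact: weight_le.
have pE : p%:R = b%:R + k%:R :> R by rewrite -natrD bk.
have k1 : 1 <= k%:R :> R by rewrite ler1n.
rewrite -mulr_natl /path_value /clique_value subrr pE.
have mE : m%:R * (m%:R - 1) = (m * m.-1)%:R :> R.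
  by rewrite natrM -subn1 natrB.
rewrite mE !(mul0r, mulr0, addr0).
suff main : (block_pairs%:R : R) * f (2 * m) + 2 * (f 4 - f 3) <
    (m * m.-1)%:R * f (2 * m) + 2 * k%:R * (3 * f 4 - 2 * f m.+1) by lra.
(* For [m > 4] the [k] spared pairs, each of weight at least [7 / 10], outweigh [2 * (f 4 - f 3)].
   For [m = 4] the term in [3 * f 4 - 2 * f 5] does. *)
have [m5|m4'] := ltnP 4 m;
  rewrite ?m5 ?(ltnNge 4) ?m4' /= ?mul1n ?mul0n ?addn0 in Npairs; last first.
  have m4E : m = 4 by apply/eqP; rewrite eqn_leq m4' m4.
  have L1 : (block_pairs%:R : R) * f (2 * m) <= (m * m.-1)%:R * f (2 * m).
    by rewrite ler_wpM2r ?weight_ge0 // ler_nat.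
  have w5 := weight5_ub R; rewrite m4E in L1 *.
  have : 1 * (3 * f 4 - 2 * f 5) <= k%:R * (3 * f 4 - 2 * f 5).
    by rewrite ler_wpM2r //; lra.
  lra.
have L1 : ((block_pairs + k)%:R : R) * f (2 * m) <= (m * m.-1)%:R * f (2 * m).
  by rewrite ler_wpM2r ?weight_ge0 // ler_nat.
have w1 := weight_le1 R m.+1.
have L2 : k%:R * (7 / 10) <= k%:R * f (2 * m) by rewrite ler_wpM2l.
have L3 : 0 <= k%:R * (3 * f 4 - 2 * f m.+1) by rewrite mulr_ge0 //; lra.
by move: L1; rewrite natrD; lra.
Qed.
End ManyBlocks.

(** * The extremal graph *)

(* Parent and level of the vertex [j] of [KK (m + p) p], for the clique
   [{0, ..., m - 1}]; both cases of its definition give the same formulas. *)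
Definition parK (m j : nat) : nat := if j < 2 * m then j - m else j.-1.
Definition levK (m j : nat) : nat :=
  if j < m then 0 else if j < 2 * m then 1 else j - 2 * m + 2.

Lemma parK_le m j : parK m j <= j.
Proof. by rewrite /parK; case: ifP; rewrite ?leq_subr ?leq_pred. Qed.

Lemma parK_inj m i j : 0 < m -> m <= i -> m <= j -> parK m i = parK m j -> i = j.
Proof. by rewrite /parK; case: (ltnP i (2 * m)); case: (ltnP j (2 * m)); lia. Qed.

Lemma levK_par m j : 0 < m -> m <= j -> levK m j = (levK m (parK m j)).+1.
Proof.
move=> m0 mj; rewrite /levK /parK ltnNge mj /=.
have [j2|j2] := ltnP j (2 * m); first by rewrite (_ : j - m < m) //; lia.
rewrite (_ : (j.-1 < m) = false); last by lia.
by case: ltnP; lia.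
Qed.

Lemma K_edge_par m p i j : 1 < m -> i < m + p -> j < m + p ->
  K_edge (m + p) p i j =
  (i < m) && (j < m) || (m <= j) && (parK m j == i).
Proof.
move=> m1 im jm; rewrite /K_edge addnK /parK; congr (_ || _).
have [pm|pm] := leqP (2 * p) (m + p).
  have -> : j < 2 * m by lia.
  apply/andP/andP => -[]; [move=> ip /eqP ->; split; last apply/eqP; lia |].
  by move=> mj /eqP ij; split; last apply/eqP; lia.
apply/or3P/andP => [[/andP[i1 /eqP->]|/andP[/eqP-> /eqP->]|/andP[i2 /eqP->]]|[mj]].
- by split; [lia | rewrite (_ : m + i < 2 * m); [apply/eqP|]; lia].
- by split; [lia | rewrite (_ : 2 * m - 1 < 2 * m); [apply/eqP|]; lia].
- by split; [lia | rewrite ltnNge (_ : 2 * m <= i.+1) //=; lia].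
case: (ltnP j (2 * m)) => j2 /eqP <-; last first.
  by apply: Or33; apply/andP; split; [|apply/eqP]; lia.
have [->|jn] := eqVneq j (2 * m - 1).
  by apply: Or32; apply/andP; split; apply/eqP; lia.
by apply: Or31; apply/andP; split; [|apply/eqP]; lia.
Qed.

(** The sibling clause is vacuous, [parK] being injective outside the clique; it is kept to match
    [ct_adj]. *)
Lemma K_edgeE m p i j : 1 < m -> i < m + p -> j < m + p -> i != j ->
  K_edge (m + p) p i j || K_edge (m + p) p j i =
  [|| (i < m) && (j < m), (m <= i) && (parK m i == j),
      (m <= j) && (parK m j == i)
    | [&& m <= i, m <= j & parK m i == parK m j]].
Proof.
move=> m1 im jm ij.
have -> : [&& m <= i, m <= j & parK m i == parK m j] = false.
  apply/negP => /and3P[mi mj /eqP /(parK_inj (ltnW m1) mi mj) /eqP].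
  by rewrite (negPf ij).
rewrite !K_edge_par // orbF (andbC (j < m)).
by do 3 case: (_ && _).
Qed.

Section KKTree.
Variables (m p : nat).
Hypothesis m1 : 1 < m.
Local Notation KG := (KK (m + p) p).

Definition parKK (i : KG) : KG :=
  Ordinal (leq_ltn_trans (parK_le m i) (ltn_ord i)).
Definition cliqueKK : {set KG} := [set i : 'I_(m + p) | i < m].

Lemma KK_clique_tree :
  clique_tree cliqueKK parKK (fun i : KG => levK m (i : 'I_(m + p))).
Proof.
have m0 := ltnW m1.
split=> [i|i|i j]; rewrite ?inE -?leqNgt.
- by rewrite /levK; case: ltnP => // _; case: ltnP => // _; rewrite addn2.
- exact: levK_par.
rewrite /= /simple_adj /= -val_eqE; case: (eqVneq (val i) (val j)) => //= ij.
by rewrite (K_edgeE m1 (ltn_ord i) (ltn_ord j) ij).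
Qed.

Lemma cliqueKK_E (i : KG) : (i \in cliqueKK) = ((i : 'I_(m + p)) < m).
Proof. by rewrite inE. Qed.

Lemma nkidsKK_le1 (i : KG) : nkids cliqueKK parKK i <= 1.
Proof.
rewrite /nkids; apply/card_le1_eqP => x y; rewrite !kidsE !cliqueKK_E -!leqNgt.
move=> /andP[mx /eqP px] /andP[my /eqP py]; apply: val_inj.
by apply: (parK_inj (ltnW m1) my mx); apply: (congr1 val (etrans py (esym px))).
Qed.

Lemma nkidsKK1 (i : KG) : (nkids cliqueKK parKK i == 1) =
  if (i : nat) < m then i < p else (2 * m <= i.+1) && (i.+1 < m + p).
Proof.
rewrite eqn_leq nkidsKK_le1 /= /nkids card_gt0.
apply/set0Pn/idP => [[x]|H].
  rewrite kidsE cliqueKK_E -leqNgt => /andP[mx /eqP/(congr1 val) /=].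
  have := ltn_ord x; rewrite /parK; move: (nat_of_ord x) mx => {}x mx xn.
  by case: ltnP => x2 <-; case: ltnP; lia.
pose j := if (i : nat) < m then m + i else i.+1.
have jn : j < m + p by rewrite /j; case: ifP H; lia.
exists (Ordinal jn); rewrite kidsE cliqueKK_E -leqNgt /= -val_eqE /= /parK /j.
by move: H; case: ltnP => // im H; [case: ltnP | case: ltnP]; lia.
Qed.

Lemma card_ltn_ord n k : k <= n -> #|[set i : 'I_n | i < k]| = k.
Proof.
move=> kn; have inj : injective (widen_ord kn).
  by move=> i j /(congr1 val) /= ij; exact: val_inj.
rewrite -[RHS]card_ord -(card_imset _ inj).
apply: eq_card => i; rewrite inE.
apply/idP/imsetP => [ik|[j _ ->] /=]; last exact: ltn_ord.
by exists (Ordinal ik) => //; apply: val_inj.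
Qed.

Lemma card_cliqueKK : #|cliqueKK| = m.
Proof. by apply: card_ltn_ord; exact: leq_addr. Qed.

Lemma card_headsKK : #|heads cliqueKK parKK| = minn m p.
Proof.
rewrite -[RHS](@card_ltn_ord (m + p)); last by lia.
apply: eq_card => i; rewrite in_set cliqueKK_E nkidsKK1 inE.
by case: ltnP => im; lia.
Qed.

Lemma card_long_kidsKK : #|long_kids cliqueKK parKK| = (m < p).
Proof.
(* The only long path starts at the last clique vertex [m - 1], whose child is [2 * m - 1]. *)
have E (i : KG) : (i \in long_kids cliqueKK parKK) =
    (m < p) && ((i : nat) == 2 * m - 1).
  rewrite in_set !cliqueKK_E nkidsKK1 /= /parK.
  have := ltn_ord i; move: (nat_of_ord i) => {}i.
  by case: (ltnP i m); case: (ltnP i (2 * m)); lia.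
have [mp|mp] := ltnP m p; last first.
  by apply: eq_card0 => i; rewrite E ltnNge mp.
have H : 2 * m - 1 < m + p by lia.
rewrite -[RHS](cards1 (Ordinal H : KG)); apply: eq_card => i.
by rewrite E mp inE.
Qed.

Lemma ABS_KK (R : realType) :
  (2 * ABS R KG = path_value R m p (minn m p) (m < p)%N)%R.
Proof.
rewrite (ABS_paths R KK_clique_tree card_cliqueKK (card_ord _) nkidsKK_le1) //.
by rewrite card_headsKK card_long_kidsKK.
Qed.
End KKTree.

(** * Uniqueness of the optimal clique with pendant paths *)

Section PathsIso.
Variables (G : sgraph) (D : {set G}) (par : G -> G) (lev : G -> nat).
Hypothesis ct : clique_tree D par lev.
Variables (m p : nat).
Hypothesis m1 : 1 < m.
Hypothesis cardD : #|D| = m.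
Hypothesis cardG : #|G| = m + p.
Hypothesis nkids_le1 : forall v, nkids D par v <= 1.
Hypothesis heads_max : #|heads D par| = minn m p.
Hypothesis long_min : #|long_kids D par| = (m < p).
Local Notation nk := (nkids D par).

Lemma kids_uniq x y v : x \in kids D par v -> y \in kids D par v -> x = y.
Proof.
by move=> xv yv; have /card_le1_eqP H := nkids_le1 v; exact: H.
Qed.

(** [D] is listed as in [KK]: heads first if [p <= m], and the head of the long path last if
    [m < p]. *)
Lemma clique_order (x0 : G) : exists s : seq G,
  [/\ uniq s, s =i D,
      forall i, i < m -> i < p -> nk (nth x0 s i) = 1 &
      forall i x, i < m -> (i.+1 < m) || (p <= m) ->
        x \in kids D par (nth x0 s i) -> nk x = 0].
Proof.
have headsD : heads D par \subset D by apply/subsetP => x; rewrite inE => /andP[].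
have [mp|pm] := ltnP m p.
  have hE : heads D par = D.
    by apply/eqP; rewrite eqEcard headsD heads_max cardD; lia.
  have nkD v : v \in D -> nk v = 1 by rewrite -{1}hE inE => /andP[_ /eqP].
  have /cards1P[w wE] : #|long_kids D par| == 1 by rewrite long_min mp.
  have wl : w \in long_kids D par by rewrite wE inE.
  have uD : par w \in D by move: wl; rewrite inE => /and3P[].
  have szs : size (enum (D :\ par w)) = m.-1.
    by rewrite -cardE -cardD (cardsD1 (par w) D) uD.
  have memE : rcons (enum (D :\ par w)) (par w) =i D.
    move=> v; rewrite mem_rcons inE mem_enum !inE.
    by case: eqVneq => [->|].
  have nthD i : i < m -> nth x0 (rcons (enum (D :\ par w)) (par w)) i \in D.
    by move=> im; rewrite -memE mem_nth // size_rcons szs; lia.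
  exists (rcons (enum (D :\ par w)) (par w)); split=> //.
  - by rewrite rcons_uniq enum_uniq mem_enum !inE eqxx.
  - by move=> i im _; apply: nkD; exact: nthD.
  move=> i x im; rewrite orbF => im'.
  have := nthD i im; rewrite nth_rcons szs (_ : i < m.-1); last by lia.
  set v := nth x0 _ i => vD; rewrite kidsE => /andP[xD /eqP pxv].
  have vw : v != par w.
    have : v \in enum (D :\ par w) by rewrite mem_nth // szs; lia.
    by rewrite mem_enum !inE => /andP[].
  apply/eqP; have := nkids_le1 x; rewrite leq_eqVlt ltnS leqn0 => /orP[k1|//].
  have : x \in long_kids D par by rewrite inE xD pxv vD.
  by rewrite wE inE => /eqP xw; rewrite -pxv xw eqxx in vw.
have noL : long_kids D par = set0 by apply/cards0_eq; rewrite long_min ltnNge pm.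
have szh : size (enum (heads D par)) = p by rewrite -cardE heads_max; lia.
exists (enum (heads D par) ++ enum (D :\: heads D par)); split.
- rewrite cat_uniq !enum_uniq andbT /=; apply/hasPn => x.
  by rewrite !mem_enum inE => /andP[].
- move=> x; rewrite mem_cat !mem_enum in_setD.
  by case: (boolP (x \in heads D par)) => [/(subsetP headsD)->|].
- move=> i im ip; rewrite nth_cat szh ip.
  have : nth x0 (enum (heads D par)) i \in heads D par.
    by rewrite -mem_enum mem_nth // szh.
  by rewrite inE => /andP[_ /eqP].
move=> i x im _; set v := nth x0 _ i => xv.
have vD : v \in D.
  have : v \in enum (heads D par) ++ enum (D :\: heads D par).
    rewrite mem_nth // size_cat szh -cardE cardsD (setIidPr headsD) cardD heads_max.
    by lia.
  rewrite mem_cat !mem_enum => /orP[/(subsetP headsD)//|].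
  by rewrite inE => /andP[].
move: xv; rewrite kidsE => /andP[xD /eqP pxv].
apply/eqP; have := nkids_le1 x; rewrite leq_eqVlt ltnS leqn0 => /orP[k1|//].
by have := in_set0 x; rewrite -noL inE xD pxv vD k1.
Qed.

(* The isomorphism [psi] sends the clique along [clique_order], and every other
   vertex [j] to the child of [psi (parK m j)]. If that child did not exist, the
   image of [{0, ..., j - 1}] would be closed under children, hence be all
   of [G]. *)
Lemma paths_isomorphic : isomorphic G (KK (m + p) p).
Proof.
have m0 := ltnW m1.
have [x0 _] : exists x : G, x \in D by apply/card_gt0P; rewrite cardD.
have [s [s_uniq sD head_kid short_kid]] := clique_order x0.
have szs : size s = m by rewrite -cardD -(eq_card sD) (card_uniqP s_uniq).
pose child v := odflt v [pick x in kids D par v].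
have childP v : nk v = 1 -> child v \in kids D par v.
  move=> k1; rewrite /child; case: pickP => //= N.
  by move: k1; rewrite /nkids eq_card0.
(* [top j] is the clique index from which [j] descends, and [levK m j] the number of steps down. *)
pose top j := if j < m then j else if j < 2 * m then j - m else m.-1.
pose psi j := iter (levK m j) child (nth x0 s (top j)).
have psi_lt j : j < m -> psi j = nth x0 s j.
  by rewrite /psi /levK /top => ->.
have psi_ge j : m <= j -> psi j = child (psi (parK m j)).
  move=> mj; rewrite /psi levK_par //= /top /parK (ltnNge j m) mj /=.
  congr (child (iter _ child (nth x0 s _))).
  have [j2|j2] := ltnP j (2 * m); first by rewrite (_ : j - m < m) //; lia.
  rewrite (_ : (j.-1 < m) = false); last by lia.
  by case: ltnP; lia.
have psi_kid_lt2 j : m <= j -> j < 2 * m -> j < m + p ->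
    nk (psi (parK m j)) = 1.
  move=> mj j2 jp; rewrite /parK j2 psi_lt; last by lia.
  by apply: head_kid; lia.
have psi_kid_all j : m <= j -> j < m + p -> nk (psi (parK m j)) = 1.
  move=> mj jp; have [j2|j2] := ltnP j (2 * m); first exact: psi_kid_lt2.
  have /orP[/eqP //|] : (nk (psi (parK m j)) == 1) || (nk (psi (parK m j)) == 0).
    by have := nkids_le1 (psi (parK m j)); case: (nk _) => [|[|]].
  rewrite {1}/parK ltnNge j2 /= => /eqP k0; exfalso.
  have kid_of x v : x \in kids D par v -> nk v = 1.
    by move=> xv; apply/eqP; rewrite eqn_leq nkids_le1; apply/card_gt0P; exists x.
  have cover x : exists2 i, i < j & x = psi i.
    move E : (lev x) => k; elim: k x E => [|k IH] x lx.
      have : x \in s by rewrite sD -(ct_lev0 ct) lx.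
      move=> xs; have ixm : index x s < m by rewrite -szs index_mem.
      exists (index x s); first by lia.
      by rewrite psi_lt // nth_index.
    have xD : x \notin D by rewrite -(ct_lev0 ct) lx.
    have [|i ij pxi] := IH (par x); first by have := ct_lev ct xD; rewrite lx => -[].
    have xk : x \in kids D par (psi i) by rewrite kidsE xD pxi eqxx.
    have xE i' : m <= i' -> parK m i' = i -> x = psi i'.
      move=> mi' pi'; rewrite (psi_ge _ mi') pi'.
      by apply: kids_uniq xk (childP _ (kid_of _ _ xk)).
    have [im|im] := ltnP i m.
      exists (m + i); first by lia.
      by apply: xE; [lia | rewrite /parK (_ : m + i < 2 * m); lia].
    (* Such an [i] ends a path of length 1, so [psi i] cannot have the child [x]. *)
    have [i2|i2] := ltnP i.+1 (2 * m).
      have ip : i < m + p by lia.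
      have i2' : i < 2 * m by lia.
      have := psi_kid_lt2 i im i2' ip => /childP.
      rewrite -(psi_ge _ im) /parK i2' (psi_lt (i - m)); last by lia.
      move=> /(short_kid (i - m)) short.
      by have := kid_of _ _ xk; rewrite short //; [lia | apply/orP; left; lia].
    have [ij'|ij'] := eqVneq i.+1 j.
      by have := kid_of _ _ xk; move: k0; rewrite -ij' /= => ->.
    exists i.+1; first by lia.
    by apply: xE; [lia | rewrite /parK ltnNge i2].
  have : #|G| <= size [seq psi i | i <- iota 0 j].
    apply: leq_trans (card_size _); apply: subset_leq_card; apply/subsetP => x _.
    by have [i ij ->] := cover x; apply: map_f; rewrite mem_iota.
  by rewrite size_map size_iota cardG leqNgt jp.
have psi_kid j : m <= j -> j < m + p -> psi j \in kids D par (psi (parK m j)).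
  by move=> mj jp; rewrite (psi_ge j mj); apply: childP; exact: psi_kid_all.
have psiD j : j < m + p -> (psi j \in D) = (j < m).
  move=> jp; have [jm|mj] := ltnP j m.
    by rewrite psi_lt // -sD mem_nth // szs.
  by have := psi_kid j mj jp; rewrite kidsE => /andP[/negPf].
have psi_par j : m <= j -> j < m + p -> par (psi j) = psi (parK m j).
  by move=> mj jp; have := psi_kid j mj jp; rewrite kidsE => /andP[_ /eqP].
have psi_inj i : forall j, i < m + p -> j < m + p -> psi i = psi j -> i = j.
  elim/ltn_ind: i => i IH j ip jp ij.
  have := psiD i ip; rewrite ij psiD //.
  have [jm|mj] := ltnP j m; have [im|mi] := ltnP i m => // _.
    by move: ij; rewrite !psi_lt // => /eqP; rewrite nth_uniq ?szs // => /eqP.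
  apply: (parK_inj m0 mi mj); apply: IH.
  - by rewrite /parK; case: (ltnP i (2 * m)); lia.
  - exact: leq_ltn_trans (parK_le m i) ip.
  - exact: leq_ltn_trans (parK_le m j) jp.
  - by rewrite -!psi_par // ij.
pose g (i : KK (m + p) p) : G := psi (i : 'I_(m + p)).
have g_inj : injective g.
  by move=> i j ij; apply: val_inj; exact: psi_inj (ltn_ord i) (ltn_ord j) ij.
have g_bij : bijective g by apply: inj_card_bij => //; rewrite cardG card_ord.
have gD i : (g i \in D) = (i \in cliqueKK m p) by rewrite psiD // cliqueKK_E.
have g_par i : i \notin cliqueKK m p -> par (g i) = g (parKK i).
  by rewrite cliqueKK_E -leqNgt => mi; rewrite psi_par.
have g_adj i j : adj (g i) (g j) = adj i j.
  rewrite (ct_adj ct) (ct_adj (KK_clique_tree p m1)) (inj_eq g_inj) !gD.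
  have [iD|iD] := boolP (i \in cliqueKK m p); have [jD|jD] := boolP (j \in cliqueKK m p);
    by rewrite /= ?g_par ?(inj_eq g_inj).
have [f fK gK] := g_bij.
exists f; first by exists g.
by move=> x y; rewrite -g_adj !gK.
Qed.
End PathsIso.

(** * Maximality *)

Lemma deg_gt0 (G : sgraph) (x : G) : connected G -> 1 < #|G| -> 0 < deg x.
Proof.
move=> [_ conG] /card_gt1P[a [b [_ _ ab]]].
have [y xy] : exists y, x != y.
  by have [E|] := eqVneq x a; [exists b; rewrite E | exists a].
have [z xz] := connect_start (conG x y) xy.
by apply/card_gt0P; exists z; rewrite inE.
Qed.

(** Degrees do not drop and are positive, where [weight] is monotone, so no old term decreases. The
    new edge has ends of degree at least 2 and positive weight. *)
Lemma ABS_add_edge (R : realType) (G : sgraph) (x y : G) :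
  connected G -> 1 < #|G| -> x != y -> ~~ adj x y ->
  (ABS R G < ABS R (add_edge x y))%R.
Proof.
move=> conG G1 xy nxy.
have subE (u v : G) : adj u v -> @adj (add_edge x y) u v by exact: add_edge_sub.
have degE (u : G) : deg u <= @deg (add_edge x y) u.
  by apply/subset_leq_card/subsetP => v; rewrite !inE; exact: subE.
have deg0 (u : G) : 0 < deg u by exact: deg_gt0.
rewrite -(@ltr_pM2l _ 2%:R) ?ltr0n // !ABS_ordered -subr_gt0.
rewrite -sumrB.
pose g (u v : G) : R :=
  ((if @adj (add_edge x y) u v
    then weight R (@deg (add_edge x y) u + @deg (add_edge x y) v) else 0)
   - (if adj u v then weight R (deg u + deg v) else 0))%R.
rewrite (eq_bigr (fun u => \sum_v g u v)%R); last first.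
  by move=> u _; rewrite [X in (X - _)%R]big_mkcond [X in (_ - X)%R]big_mkcond -sumrB.
have g_ge0 u v : (0 <= g u v)%R.
  rewrite /g subr_ge0; case: ifP => [/subE->|_]; last first.
    by case: ifP => // _; exact: weight_ge0.
  by apply: weight_le; [rewrite addn_gt0 deg0 | exact: leq_add].
rewrite (bigD1 x) //= ltr_wpDr //; first by apply: sumr_ge0 => u _; apply: sumr_ge0.
rewrite (bigD1 y) //= ltr_wpDr //; first exact: sumr_ge0.
have axy : @adj (add_edge x y) x y by rewrite (@add_edgeE G) // !eqxx orbT.
rewrite /g axy (negPf nxy) subr0; apply: weight_gt0.
have ltd (u v : G) : @adj (add_edge x y) u v -> ~~ adj u v -> 1 < @deg (add_edge x y) u.
  move=> auv nuv; apply: (leq_ltn_trans (deg0 u)); apply: proper_card.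
  apply/properP; split; first by apply/subsetP => w; rewrite !inE; exact: subE.
  by exists v; rewrite inE.
have ayx : @adj (add_edge x y) y x by rewrite (@adj_sym (add_edge x y)).
have nyx : ~~ adj y x by rewrite adj_sym.
by apply: (leq_trans _ (leq_add (ltd x y axy nxy) (ltd y x ayx nyx))).
Qed.

(** * Saturated graphs: one large clique or several large blocks *)

Section Extremal.
Variables (R : realType) (G : sgraph) (m p : nat).
Hypothesis conG : connected G.
Hypothesis m1 : 1 < m.
Hypothesis cardG : #|G| = m + p.
Hypothesis card_cut : #|[set v : G | cut_vertex v]| = p.
Hypothesis n3 : 2 < m + p.

Definition is_clique (A : {set G}) : bool :=
  [forall x in A, forall y in A, (x != y) ==> adj x y].

Lemma is_cliqueP (A : {set G}) :
  reflect (forall x y, x \in A -> y \in A -> x != y -> adj x y) (is_clique A).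
Proof.
apply: (iffP 'forall_in_'forall_in_implyP) => H x; last by move=> xA y yA; exact: H.
by move=> y xA yA; exact: H.
Qed.

Lemma clique_maximal (D E : {set G}) : is_clique D -> #|E| <= #|D| ->
  (forall A, is_clique A -> #|A| <= #|E|) ->
  forall x, x \notin D -> exists2 y, y \in D & ~~ adj x y.
Proof.
move=> /is_cliqueP cD ED maxE x xD.
have : ~~ is_clique (x |: D).
  apply/negP => /maxE; rewrite cardsU1 xD; lia.
move=> ncl; apply/exists_inP; apply: contraNT ncl => /exists_inPn H.
apply/is_cliqueP => u v.
have adjx y : y \in D -> adj x y.
  by move=> yD; have := H y yD; rewrite negbK.
move=> /setU1P[->|uD] /setU1P[->|vD]; rewrite ?eqxx // => uv.
- exact: adjx.
- by rewrite adj_sym; exact: adjx.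
- exact: cD.
Qed.

Lemma is_clique2 (x y : G) : adj x y -> is_clique [set x; y].
Proof.
move=> xy; apply/is_cliqueP => u v; rewrite !inE.
move=> /orP[]/eqP-> /orP[]/eqP->; rewrite ?eqxx // => _ //.
by rewrite adj_sym.
Qed.

(** As [p] is less than the order, some [l] is not a cut vertex; [G - l] is connected with at least
    two vertices, so [w] has a neighbour other than [l]. The edge [wz] serves as root clique when
    [m = 2]. *)
Lemma noncut_edge : exists l w z : G,
  [/\ ~~ cut_vertex l, adj l w, adj w z & l \notin [set w; z]].
Proof.
have [l] : exists l : G, l \notin [set v : G | cut_vertex v].
  apply/existsP; apply: contraT => /existsPn H.
  have : [set v : G | cut_vertex v] = [set: G].
    by apply/setP => v; have := H v; rewrite negbK inE => ->; rewrite inE.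
  by move=> E; have := card_cut; rewrite E cardsT cardG; lia.
rewrite inE => ncl.
have [y yl] : exists y, y \notin [set l].
  apply/existsP; apply: contraT => /existsPn H.
  have : #|G| <= #|[set l]|.
    by apply/subset_leq_card/subsetP => v _; have := H v; rewrite negbK.
  rewrite cards1 cardG; lia.
rewrite inE eq_sym in yl.
have [w lw] := connect_start (proj2 conG l y) yl.
have [y' yw] : exists y, y \notin [set l; w].
  apply/existsP; apply: contraT => /existsPn H.
  have : #|G| <= #|[set l; w]|.
    by apply/subset_leq_card/subsetP => v _; have := H v; rewrite negbK.
  rewrite cards2 cardG; case: (_ != _); lia.
rewrite !inE negb_or in yw; case/andP: yw => yl' yw.
have wl : w != l by rewrite eq_sym; exact: adj_neq.
have [z] : exists z, del_adj l w z.
  by apply: (connect_start (noncut_connect conG ncl wl yl')); rewrite eq_sym.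
move=> /and3P[_ zl wz]; exists l, w, z; split=> //.
by rewrite !inE negb_or eq_sym wl eq_sym zl.
Qed.

(** The leaf [l] is itself a path of length 1 at [w], so not every path is long. *)
Lemma heads_gt_long (D : {set G}) (par : G -> G) (lev : G -> nat) (l w : G) :
  clique_tree D par lev -> #|D| = m -> (forall v, nkids D par v <= 1) ->
  nkids D par l = 0 -> l \notin D -> w \in D -> adj l w ->
  #|long_kids D par| < #|heads D par|.
Proof.
move=> ct cardD nk1 kl lD wD lw.
have pl : par l = w.
  have := ct_adj ct l w; rewrite lw => /esym/andP[_].
  by rewrite (negPf lD) wD /= !orbF => /eqP.
rewrite -(card_sum1 nk1) -card_kids_of //.
apply: proper_card; apply/properP; split.
  by apply/subsetP => x; rewrite !inE => /and3P[-> ->].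
by exists l; rewrite !inE ?lD ?pl ?wD // kl.
Qed.

Lemma path_case (D : {set G}) (par : G -> G) (lev : G -> nat) :
  clique_tree D par lev -> #|D| = m -> (forall v, nkids D par v <= 1) ->
  (m = 2 -> 0 < p -> #|long_kids D par| < #|heads D par|) ->
  (ABS R G < ABS R (KK (m + p) p))%R \/
  (ABS R G = ABS R (KK (m + p) p) /\ isomorphic G (KK (m + p) p)).
Proof.
move=> ct cardD nk1 m2.
have [sq qm qsp s0] := card_heads_long ct cardD cardG nk1.
have [/andP[/eqP qE /eqP sE]|] :=
  boolP ((#|heads D par| == minn m p) && (#|long_kids D par| == (m < p))).
  have iso := paths_isomorphic ct m1 cardD cardG nk1 qE sE.
  by right; split=> //; exact: isomorphic_ABS.
rewrite negb_and => neq; left.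
rewrite -(@ltr_pM2l _ 2%:R) ?ltr0n // ABS_KK // (ABS_paths R ct cardD cardG nk1) //.
exact: path_value_max.
Qed.

Lemma block_case (D : {set G}) (par : G -> G) (lev : G -> nat) :
  clique_tree D par lev -> #|[set v | 0 < nkids D par v]| = p ->
  (forall v, nkids D par v < #|D|) -> #|D| < m ->
  (ABS R G < ABS R (KK (m + p) p))%R.
Proof.
move=> ct cut lt_nk lt_a.
rewrite -(@ltr_pM2l _ 2%:R) ?ltr0n // ABS_KK //.
have [mp|pm] := ltnP m p.
  exact: (ABS_blocks_many R ct cut cardG lt_nk lt_a mp).
apply: lt_le_trans (ABS_blocks_few R ct cut cardG lt_nk lt_a pm) _.
(* The bound just used gives all clique vertices degree [m - 1], which is the clique value at
   [q = 0]. *)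
have := @clique_value_mono R m 0 p m1 (leq0n _) pm.
rewrite /path_value /clique_value.
rewrite !(mul0r, mulr0, add0r, subr0, subrr, addr0) -mulrA.
have -> : ((m * m.-1)%:R = m%:R * (m%:R - 1) :> R)%R.
  by rewrite natrM -subn1 natrB // ltnW.
lra.
Qed.

Hypothesis satG : saturated G.

Lemma saturated_max :
  (ABS R G < ABS R (KK (m + p) p))%R \/
  (ABS R G = ABS R (KK (m + p) p) /\ isomorphic G (KK (m + p) p)).
Proof.
have [l [w [z [ncl lw wz lwz]]]] := noncut_edge.
have [E cE maxE] : exists2 E, is_clique E & forall A, is_clique A -> #|A| <= #|E|.
  have c2 := is_clique2 wz.
  by case: (arg_maxnP (fun A : {set G} => #|A|) c2) => E cE maxE; exists E.
have cwz := is_clique2 wz.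
have card_wz : #|[set w; z]| = 2 by rewrite cards2 (adj_neq wz).
have E2 : 2 <= #|E| by rewrite -card_wz maxE.
have tree D : is_clique D -> #|D| = #|E| ->
    exists (par : G -> G) (lev : G -> nat), clique_tree D par lev /\
    forall c, cut_vertex c = (0 < nkids D par c).
  move=> cD cardD; have D2 : 1 < #|D| by rewrite cardD.
  have mD := clique_maximal cD (eq_leq (esym cardD)) maxE.
  have [par [lev [ct cut]]] := saturated_clique_tree conG satG (is_cliqueP _ cD) mD D2.
  exists par, lev; split=> // c; rewrite cut; apply/existsP/card_gt0P => -[x].
    by exists x; rewrite kidsE.
  by rewrite kidsE; exists x.
have cut_card (D : {set G}) par lev : clique_tree D par lev ->
    (forall c, cut_vertex c = (0 < nkids D par c)) ->
    #|[set v | 0 < nkids D par v]| = p.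
  by move=> ct cut; rewrite -card_cut; apply: eq_card => v; rewrite !inE cut.
have [par [lev [ct cut]]] := tree E cE erefl.
have cutp := cut_card _ _ _ ct cut.
have excess := sum_excess cutp cardG.
have [lt_a|le_a] := ltnP #|E| m.
  left; apply: (block_case ct) => // v.
  have [->|kv] := posnP (nkids E par v); first exact: ltnW.
  have vk : v \notin kids E par v by apply/negP => /(kid_neq ct); rewrite eqxx.
  (* A vertex and its children form a clique, so they are no more numerous than the maximum clique
     [E]. *)
  have := maxE (v |: kids E par v); rewrite cardsU1 vk; apply.
  apply/is_cliqueP => x y; rewrite !in_setU1 !kidsE.
  move=> /orP[/eqP->|/andP[xE /eqP px]] /orP[/eqP->|/andP[yE /eqP py]] xy;
    rewrite (ct_adj ct) xy /=.
  - by rewrite eqxx in xy.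
  - by rewrite yE py eqxx !orbT.
  - by rewrite xE px eqxx !orbT.
  - by rewrite xE yE px py eqxx !orbT.
have aE : #|E| = m by lia.
have small (D : {set G}) par' lev' : clique_tree D par' lev' -> #|D| = m ->
    (forall c, cut_vertex c = (0 < nkids D par' c)) -> forall v, nkids D par' v <= 1.
  move=> ct' aD cut' v; have := sum_excess (cut_card _ _ _ ct' cut') cardG.
  rewrite aD (bigD1 v) //=; lia.
(* For [m = 2] the graph is a path and every edge is a maximum clique: [E] has to
   be replaced by an edge next to an end of the path. *)
have [m2|m3] := eqVneq m 2; last first.
  by apply: (path_case ct aE (small _ _ _ ct aE cut)) => m2; rewrite m2 in m3.
have [par' [lev' [ct' cut']]] := tree _ cwz ltac:(by rewrite card_wz aE m2).
have aD : #|[set w; z]| = m by rewrite card_wz m2.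
have nk1 := small _ _ _ ct' aD cut'.
apply: (path_case ct' aD nk1) => _ _.
apply: (heads_gt_long ct' aD nk1 _ lwz _ lw); last by rewrite !inE eqxx.
by apply/eqP; move: ncl; rewrite cut' -eqn0Ngt.
Qed.
End Extremal.

(** Induction on the number of non-adjacent ordered pairs: an unsaturated graph gains an edge that
    keeps its cut vertices and strictly raises ABS, so only saturated graphs can attain equality. *)
Lemma ABS_max (R : realType) (m p : nat) (G : sgraph) :
  1 < m -> 2 < m + p -> in_V (m + p) p G ->
  (ABS R G < ABS R (KK (m + p) p))%R \/
  (ABS R G = ABS R (KK (m + p) p) /\ isomorphic G (KK (m + p) p)).
Proof.
move=> m1 n3.
move E : #|[set u : G * G | ~~ adj u.1 u.2]| => k.
elim/ltn_ind: k G E => k IH G E GV; have [conG cardG cutG] := GV.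
have [satG|[x [y [xy nxy cutE]]]] := saturated_or_extend conG.
  exact: saturated_max.
left; have G1 : 1 < #|G| by rewrite cardG; lia.
have lt := ABS_add_edge R conG G1 xy nxy.
have V' := in_V_add_edge xy cutE GV.
have [|lt'|[eq' _]] := IH _ _ (add_edge x y) erefl V'.
- rewrite -E; apply: proper_card; apply/properP; split.
    by apply/subsetP => u; rewrite !inE; apply: contra; exact: add_edge_sub.
  have axy : @adj (add_edge x y) x y by rewrite (@add_edgeE G) // !eqxx orbT.
  by exists (x, y); rewrite inE // negbK; exact: axy.
- exact: lt_trans lt lt'.
- by rewrite -eq'.
Qed.

Theorem theorem2p3 (R : realType) (n p : nat) (G : sgraph) :
  3 <= n -> p <= n - 2 -> in_V n p G ->
  (ABS R G <= ABS R (KK n p))%R /\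
  (ABS R G = ABS R (KK n p) <-> isomorphic G (KK n p)).
Proof.
move=> n3 pn GV.
have nE : n = (n - p) + p by lia.
have m1 : 1 < n - p by lia.
have n3' : 2 < (n - p) + p by lia.
rewrite nE in GV.
have := ABS_max R m1 n3' GV; rewrite -nE => -[lt|[eqA iso]].
  split; first exact: ltW.
  by split=> [eqA|/(isomorphic_ABS R) eqA]; rewrite eqA ltxx in lt.
by rewrite eqA; split.
Qed.
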